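(* Let $n\ge 2$ and let $X_1(t),\dots,X_n(t)$, $t\ge 0$, be independent Goldstein-Kac telegraph processes on $\mathbb{R}$ with speeds $c_k>0$, Poisson rates $\lambda_k>0$ and starting points $x_k^0\in\mathbb{R}$, $k=1,\dots,n$. Let $a_1,\dots,a_n$ be real non-zero constants, and let $L(t)=\sum_{k=1}^n a_kX_k(t)$. Let $\mathfrak{D}_n=\operatorname{diag}\{A_1,\dots,A_{2^n}\}$ be the diagonal $2^n\times 2^n$ matrix of differential operators and $\mathbf{\Lambda}_n$ the scalar $2^n\times 2^n$ matrix defined in the context. Then the transition probability density $p(x,t)$ of the process $L(t)$ satisfies, for $x\in\mathbb{R}$, $t>0$, the following hyperbolic partial differential equation of order $2^n$ with constant coefficients: $$\left\{\operatorname{Det}\left[\mathfrak{D}_n+\mathbf{\Lambda}_n\right]\right\}p(x,t)=0,$$ where $\operatorname{Det}[\mathfrak{D}_n+\mathbf{\Lambda}_n]$ is the determinant of the matrix differential operator $\mathfrak{D}_n+\mathbf{\Lambda}_n$ (whose entries lie in the commutative ring of constant-coefficient differential operators in $\partial/\partial t,\partial/\partial x$).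
   Context: Telegraph process: given $c>0$, $\lambda>0$, $x^0\in\mathbb{R}$, the Goldstein-Kac telegraph process with speed $c$, rate $\lambda$ and starting point $x^0$ is the position $X(t)$ of a particle that starts from $x^0$ at time $0$, picks an initial direction $D(0)\in\{-1,+1\}$ with probabilities $1/2$ each, moves with constant speed $c$, and instantaneously reverses direction at every event of a homogeneous Poisson process $N(t)$ of rate $\lambda$ independent of $D(0)$. Thus $D(t)=D(0)(-1)^{N(t)}$ is the direction at time $t$ and $X(t)=x^0+c\int_0^t D(s)\,ds$. Independence of $X_1,\dots,X_n$ means that all the initial directions and all the governing Poisson processes $N_1,\dots,N_n$ are mutually independent. Let $\boldsymbol\sigma_1,\dots,\boldsymbol\sigma_{2^n}$ be the elements $\boldsymbol\sigma_k=\{i_1^{(k)},\dots,i_n^{(k)}\}$ of $\{-1,+1\}^n$ listed in lexicographical order (with $-1<+1$), so $\boldsymbol\sigma_1=\{-1,\dots,-1,-1\}$, $\boldsymbol\sigma_2=\{-1,\dots,-1,+1\}$, ..., $\boldsymbol\sigma_{2^n}=\{+1,\dots,+1\}$. Let $\rho$ be the Hamming metric on $\{-1,+1\}^n$ (number of positions in which two sequences differ). Put $$\mathbf{c}_k=\sum_{j=1}^n a_j i_j^{(k)}c_j,\qquad A_k=\frac{\partial}{\partial t}+\mathbf{c}_k\frac{\partial}{\partial x},\qquad k=1,\dots,2^n,\qquad \boldsymbol\lambda=\sum_{j=1}^n\lambda_j.$$ The matrix $\mathbf{\Lambda}_n=\|\xi_{sm}\|_{s,m=1}^{2^n}$ has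 entries $\xi_{sm}=\boldsymbol\lambda$ if $s=m$; $\xi_{sm}=-\lambda_k$ if $\rho(\boldsymbol\sigma_s,\boldsymbol\sigma_m)=1$ and $k$ is the unique position with $i_k^{(s)}\ne i_k^{(m)}$; and $\xi_{sm}=0$ otherwise. The transition density is $p(x,t)=\sum_{k=1}^{2^n}f_k(x,t)$, where $f_k(x,t)\,dx=\Pr\{x<L(t)<x+dx,\ D_1(t)=i_1^{(k)},\dots,D_n(t)=i_n^{(k)}\}$ and $D_j(t)$ is the direction of $X_j$ at time $t$; i.e. $p(\cdot,t)$ is the density of the distribution of $L(t)$. Since this distribution has atoms, $p$ is understood as a generalized function (tempered distribution in $x$ for each $t$) and the differential equation is understood in the sense of generalized functions. A scalar constant-coefficient operator $P(\partial_t,\partial_x)$ of order $m$ is hyperbolic (with respect to $t$) in the usual sense (Gårding) if the coefficient of $\partial_t^m$ is non-zero and there is a constant $M$ such that, for every $\xi\in\mathbb{R}$, all complex roots $\tau$ of $P(\tau,i\xi)=0$ satisfy $|\operatorname{Re}\tau|\le M$. *)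

(* Defs.v *)
From HB Require Import structures.
From mathcomp Require Import all_boot all_order all_algebra.
From mathcomp Require Import polyXY complex.
From mathcomp Require Import all_classical all_reals all_analysis.

Set Implicit Arguments.
Unset Strict Implicit.
Unset Printing Implicit Defensive.

Import Order.TTheory GRing.Theory Num.Theory.
Import numFieldNormedType.Exports.

Local Open Scope classical_set_scope.
Local Open Scope ring_scope.

Definition mutually_independent (R : realType) (d : measure_display)
    (T : measurableType d) (P : probability T R) (I : finType)
    (F : I -> set (set T)) : Prop :=
  forall (J : {set I}) (A : I -> set T),
    (forall i, i \in J -> F i (A i)) ->
    P (\bigcap_(i in [set` J]) A i) = (\prod_(i in J) P (A i))%E.

Definition sigma_of (T : Type) (d' : measure_display) (T' : measurableType d')
    (Y : T -> T') : set (set T) :=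
  preimage_set_system setT Y measurable.

Definition sigma_of_process (R : realType) (T : Type) (d' : measure_display)
    (T' : measurableType d') (Y : R -> T -> T') : set (set T) :=
  <<s \bigcup_(t in [set t : R | 0 <= t]) sigma_of (Y t) >>.

(* Only the values N t with 0 <= t are constrained.  The law of an increment
   is required for s < t only, because the library sets [poisson_pmf 0 k] to
   1 for every k. *)
Record poisson_process (R : realType) (d : measure_display)
    (T : measurableType d) (P : probability T R) (lam : R)
    (N : R -> T -> nat) : Prop := {
  poisson_measurable : forall t, 0 <= t -> measurable_fun setT (N t);
  poisson_start : forall w, N 0 w = 0%N;
  poisson_mono : forall w s t, 0 <= s -> s <= t -> (N s w <= N t w)%N;
  poisson_rcont : forall w t, 0 <= t -> \forall s \near t^'+, N s w = N t w;
  poisson_indep_incr : forall (m : nat) (t : nat -> R),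
    0 <= t 0%N -> (forall i, t i <= t i.+1) ->
    mutually_independent P
      (fun i : 'I_m => sigma_of (fun w => (N (t i.+1) w - N (t i) w)%N));
  poisson_law : forall s t (k : nat), 0 <= s -> s < t ->
    P [set w | (N t w - N s w)%N = k] = (poisson_pmf (lam * (t - s)) k)%:E
}.

Record initial_direction (R : realType) (d : measure_display)
    (T : measurableType d) (P : probability T R) (D0 : T -> R) : Prop := {
  direction_measurable : measurable_fun setT D0;
  direction_values : forall w, D0 w = -1 \/ D0 w = 1;
  direction_neg : P [set w | D0 w = -1] = (2^-1)%:E;
  direction_pos : P [set w | D0 w = 1] = (2^-1)%:E
}.

Definition direction (R : realType) (T : Type) (D0 : T -> R)
    (N : R -> T -> nat) (t : R) (w : T) : R :=
  D0 w * (-1) ^+ N t w.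

Definition telegraph (R : realType) (T : Type) (c x0 : R) (D0 : T -> R)
    (N : R -> T -> nat) (t : R) (w : T) : R :=
  x0 + c * \int[lebesgue_measure]_(s in `[0, t]) direction D0 N s w.

(* All initial directions and all Poisson processes are jointly independent:
   [inl j] indexes the j-th direction, [inr j] the j-th Poisson process. *)
Definition independent_telegraph_data (R : realType) (d : measure_display)
    (T : measurableType d) (P : probability T R) (n : nat)
    (D0 : 'I_n -> T -> R) (N : 'I_n -> R -> T -> nat) : Prop :=
  mutually_independent P (fun i : 'I_n + 'I_n =>
    match i with
    | inl j => sigma_of (D0 j)
    | inr j => sigma_of_process (N j)
    end).

Definition lin_comb (R : realType) (T : Type) (n : nat) (a : 'I_n -> R)
    (X : 'I_n -> R -> T -> R) (t : R) (w : T) : R :=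
  \sum_(j < n) a j * X j t w.

(* Lexicographical enumeration of {-1,+1}^n, with indices shifted to start at
   0: reading -1 as 0 and +1 as 1, [sigma k] is the binary expansion of k on n
   digits, most significant digit first. *)
Definition sigma (n : nat) (k : 'I_(2 ^ n)) (j : 'I_n) : int :=
  if odd (k %/ 2 ^ (n - j.+1)) then 1 else -1.

Definition hamming (n : nat) (s m : 'I_(2 ^ n)) : nat :=
  #|[set j : 'I_n | sigma s j != sigma m j]|.

(* Constant-coefficient operators in d/dt and d/dx are elements of
   {poly {poly R}}: the outer variable is d/dt, the inner one is d/dx, and
   [P`_i`_j] is the coefficient of (d/dt)^i (d/dx)^j. *)
Definition A_op (R : realType) (n : nat) (a c : 'I_n -> R) (k : 'I_(2 ^ n)) :
    {poly {poly R}} :=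
  'X + ((\sum_(j < n) a j * (sigma k j)%:~R * c j) *: 'X)%:P.

Definition D_mx (R : realType) (n : nat) (a c : 'I_n -> R) :
    'M[{poly {poly R}}]_(2 ^ n) :=
  diag_mx (\row_k A_op a c k).

(* In the Hamming distance 1 case the sum has exactly one term, the rate of
   the unique position where the two sequences differ. *)
Definition Lambda_mx (R : realType) (n : nat) (lam : 'I_n -> R) :
    'M[R]_(2 ^ n) :=
  \matrix_(s, m)
    if s == m then \sum_(j < n) lam j
    else if hamming s m == 1%N
         then - \sum_(j < n | sigma s j != sigma m j) lam j
    else 0.

Definition det_op (R : realType) (n : nat) (a c lam : 'I_n -> R) :
    {poly {poly R}} :=
  \det (D_mx a c + map_mx (fun r : R => r%:P%:P) (Lambda_mx lam)).

Definition op_order (R : realType) (P : {poly {poly R}}) : nat :=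
  \max_(i < size P | P`_i != 0) (i + (size (P`_i)%R).-1)%N.

(* Garding's condition with respect to t: the term of top order in d/dt is
   present, and the roots tau of P(tau, i xi) lie in a fixed vertical strip. *)
Definition hyperbolic (R : realType) (P : {poly {poly R}}) : Prop :=
  P`_(op_order P)`_0 != 0 /\
  exists M : R, forall (xi : R) (tau : R[i]),
    (map_poly (map_poly (real_complex R)) P).[tau, Complex 0 xi] = 0 ->
    `|complex.Re tau| <= M.

(* Points of R * R are pairs (x, t). *)
Definition dx (R : realType) (f : R * R -> R) : R * R -> R :=
  'D_((1, 0) : R * R) f.

Definition dt (R : realType) (f : R * R -> R) : R * R -> R :=
  'D_((0, 1) : R * R) f.

(* Iterated partial derivatives in an arbitrary order (true for d/dt). *)
Definition partials (R : realType) (s : seq bool) (f : R * R -> R) :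
    R * R -> R :=
  foldr (fun b g => if b then dt g else dx g) f s.

Definition smooth2 (R : realType) (f : R * R -> R) : Prop :=
  forall s : seq bool,
    continuous (partials s f) /\
    forall z : R * R, derivable (partials s f) z (1, 0) /\
                      derivable (partials s f) z (0, 1).

(* Test functions are smooth, supported in t in a compact subset of (0, +oo)
   and of Schwartz class in x; this class contains C_c^oo(R x (0, +oo)). *)
Definition test_function (R : realType) (f : R * R -> R) : Prop :=
  [/\ smooth2 f,
      exists t0 t1 : R, 0 < t0 /\
        forall x t : R, ~~ (t0 <= t <= t1) -> f (x, t) = 0
    & forall (s : seq bool) (m : nat), exists M : R,
        forall x t : R, `|x| ^+ m * `|partials s f (x, t)| <= M].

Definition adjoint_op (R : realType) (P : {poly {poly R}})
    (f : R * R -> R) (z : R * R) : R :=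
  \sum_(i < size P) \sum_(j < size P`_i)
    (-1) ^+ (i + j) * P`_i`_j * iter i (@dt R) (iter j (@dx R) f) z.

(* A family u of generalized functions in x, [u t psi] being the pairing of
   u(., t) with psi, defines the generalized function
     phi |-> int_0^oo u t (phi (., t)) dt
   on the half-plane t > 0; [gen_solution P u] says that P annihilates it. *)
Definition gen_solution (R : realType) (P : {poly {poly R}})
    (u : R -> (R -> R) -> R) : Prop :=
  forall phi : R * R -> R, test_function phi ->
    \int[lebesgue_measure]_(t in `]0, +oo[)
      u t (fun x => adjoint_op P phi (x, t)) = 0.

(* Pairing with psi of the generalized function f_k(., t), where
   f_k(x, t) dx = Pr (x < L t < x + dx, D_j t = i_j^(k) for all j). *)
Definition f_density (R : realType) (d : measure_display)
    (T : measurableType d) (P : probability T R) (n : nat)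
    (L : R -> T -> R) (D : 'I_n -> R -> T -> R) (k : 'I_(2 ^ n))
    (t : R) (psi : R -> R) : R :=
  \int[P]_(w in [set w | forall j, D j t w = (sigma k j)%:~R]) psi (L t w).

Definition p_density (R : realType) (d : measure_display)
    (T : measurableType d) (P : probability T R) (n : nat)
    (L : R -> T -> R) (D : 'I_n -> R -> T -> R)
    (t : R) (psi : R -> R) : R :=
  \sum_(k < 2 ^ n) f_density P L D k t psi.

(* Main.v *)
From HB Require Import structures.
From mathcomp Require Import all_boot all_order all_algebra.
From mathcomp Require Import perm polyXY complex ring lra zify.
From mathcomp Require Import all_classical all_reals all_analysis.
From mathcomp Require Import measurable_realfun.
Require Import Defs.

Set Implicit Arguments.
Unset Strict Implicit.
Unset Printing Implicit Defensive.

Import Order.TTheory GRing.Theory Num.Theory.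
Import numFieldNormedType.Exports.

Local Open Scope classical_set_scope.
Local Open Scope ring_scope.

(** Let [f_k (x, t)] be the density of the position on the event that the
    directions at time [t] form the sign vector [sigma k].  During a short
    time [delta] the direction [j] alone flips with probability
    [lam j * delta], no direction flips with probability
    [1 - (sum of the lam j) * delta], and anything else costs [O(delta ^ 2)];
    while no direction flips, the position moves at the speed [drift k].
    Hence the [f_k] solve the first-order system [M f = 0], where [M] is the
    matrix [op_mx] of operators [D_mx + Lambda_mx].  Its entries commute, so
    [\adj M * M = \det M] gives [\det M f_k = 0] for each [k], and the
    density of the position is the sum of the [f_k].

    Everything is read through test functions: [phase_mean k f t] is the
    pairing of [f_k (., t)] with [f (., t)].  The short-time analysis says
    that [g := phase_mean k f] satisfies
    [|g (s + delta) - g s - delta * h s| <= K * delta ^ 2] uniformly in [s],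
    where [h] is the pairing with minus the adjoint of row [k] of [M]
    ([phase_mean_first_order]).  Because the bound is uniform and [h] is
    Lipschitz, [h] is the derivative of [g] and integrates to zero as soon as
    [f] has compact support in time ([integral_of_derive]).  This is applied
    to the images of a test function under the adjoints of the entries of
    [\adj M]; that adjoints compose as products do rests on the symmetry of
    second derivatives ([dx_dt]).

    The probabilistic core is that the increments of the Poisson processes
    over [s, s + delta] are independent of the directions and of the position
    at time [s] ([expect_state_indep]).  The position is an integral over the
    whole past, but the directions at finitely many grid times take finitely
    many values, and for them the factorization is a computation with
    products of probabilities ([level_set_indep]).  Riemann sums on the grid
    converge to the position, with an error of at most twice the mesh times
    the number of jumps ([riemann_error]), and dominated convergence concludes.

    As a polynomial in d/dt, [\det M] is a characteristic polynomial, hence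
    monic of degree [2 ^ n]; entries of total degree at most 1 make the total
    degree at most [2 ^ n].  If [tau] is a root above [i xi], then
    [tau + i xi * drift + Lambda_mx] is singular, and the largest entry of a
    kernel vector shows that [|tau + i xi * drift k|] is bounded by the
    entries of [Lambda_mx] for some [k]; its real part is that of [tau]. *)

(** * Order and hyperbolicity of the determinant *)

Section Algebra.
Variable R : realType.
Implicit Types P Q : {poly {poly R}}.

(** Total degree in both variables, the size of a polynomial over polynomials
    being its degree in the outer variable alone. *)
Definition tdeg_le (d : nat) P := forall i j, (d < i + j)%N -> P`_i`_j = 0.

Lemma tdeg_leM d1 d2 P Q : tdeg_le d1 P -> tdeg_le d2 Q ->
  tdeg_le (d1 + d2) (P * Q).
Proof.
move=> hP hQ i j hij; rewrite coefM coef_sum big1// => k _.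
rewrite coefM big1// => l _.
have [h|h] := ltnP d1 (k + l); first by rewrite hP ?mul0r.
rewrite hQ ?mulr0//.
have := ltn_ord k; have := ltn_ord l; rewrite !ltnS => lj ki.
rewrite -(ltn_add2l (k + l)) addnACA (subnKC ki) (subnKC lj).
by apply: leq_ltn_trans hij; rewrite leq_add2r.
Qed.

Lemma tdeg_le_sum d (I : finType) (F : I -> {poly {poly R}}) :
  (forall i, tdeg_le d (F i)) -> tdeg_le d (\sum_i F i).
Proof. by move=> h i j hij; rewrite !coef_sum big1// => k _; rewrite h. Qed.

Lemma tdeg_le_prod (I : finType) (F : I -> {poly {poly R}}) :
  (forall i, tdeg_le 1 (F i)) -> tdeg_le #|I| (\prod_i F i).
Proof.
move=> h; rewrite -sum1_card.
apply: (big_ind2 (fun P (d : nat) => tdeg_le d P)) => //.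
- by move=> [|i] [|j]//= _; rewrite coef1 ?coef1 ?coef0.
- by move=> P d1 Q d2; exact: tdeg_leM.
Qed.

Lemma tdeg_le_det m (M : 'M[{poly {poly R}}]_m) :
  (forall i j, tdeg_le 1 (M i j)) -> tdeg_le m (\det M).
Proof.
move=> h; apply: tdeg_le_sum => s i j hij.
have := @tdeg_le_prod _ (fun i => M i (s i)) (fun i => h i (s i)).
rewrite card_ord => /(_ i j hij) => e.
by rewrite -signr_odd; case: odd; rewrite ?mul1r// mulN1r !coefN e oppr0.
Qed.

Variables (n : nat) (a c lam : 'I_n -> R).

Definition drift (k : 'I_(2 ^ n)) : R :=
  \sum_(j < n) a j * (sigma k j)%:~R * c j.

Definition op_mx : 'M[{poly {poly R}}]_(2 ^ n) :=
  D_mx a c + map_mx (fun r : R => r%:P%:P) (Lambda_mx lam).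

Lemma op_mxE i j : op_mx i j =
  (if i == j then 'X + (drift j *: 'X)%:P else 0) + (Lambda_mx lam i j)%:P%:P.
Proof.
rewrite /op_mx /D_mx !mxE eq_sym.
by case: eqP => [->|_]; rewrite ?mulr1n ?mulr0n.
Qed.

Lemma op_mx_tdeg i j : tdeg_le 1 (op_mx i j).
Proof.
move=> p q; rewrite op_mxE; case: eqP => _; rewrite ?add0r ?coefD ?coefX !coefC;
case: p q => [|[|p]] [|[|q]]//= _; rewrite ?coefD ?coef0 ?addr0 ?coefZ ?coefX ?coefC//=
  ?mulr0 ?addr0 ?add0r ?coef1 ?coef0//.
Qed.

(** The variable d/dt occurs in [op_mx] only as ['X] on the diagonal. *)
Lemma op_mx_char_poly : \det op_mx = char_poly
  (- (diag_mx (\row_k (drift k *: 'X)) + map_mx polyC (Lambda_mx lam))).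
Proof.
congr (\det _); apply/matrixP => i j.
rewrite op_mxE !mxE eq_sym; case: eqP => [->|_].
  by rewrite !mulr1n rmorphN rmorphD/= opprK addrA.
by rewrite !mulr0n !add0r rmorphN/= opprK.
Qed.

Lemma det_op_lead : (det_op a c lam)`_(2 ^ n) = 1.
Proof.
rewrite -[det_op _ _ _]/(\det op_mx) op_mx_char_poly.
have /monicP := char_poly_monic (- (diag_mx (\row_k (drift k *: 'X)) +
  map_mx polyC (Lambda_mx lam))).
by rewrite /lead_coef size_char_poly.
Qed.

Lemma op_order_det_op : op_order (det_op a c lam) = (2 ^ n)%N.
Proof.
apply/eqP; rewrite eqn_leq; apply/andP; split.
  apply/bigmax_leqP => i nz.
  rewrite leqNgt; apply/negP => h.
  have := tdeg_le_det op_mx_tdeg h.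
  by move/eqP; rewrite -[X in X == 0]/(lead_coef _) lead_coef_eq0; apply/negP.
have sz : (2 ^ n < size (det_op a c lam))%N.
  rewrite -[det_op _ _ _]/(\det op_mx) op_mx_char_poly size_char_poly.
  exact: ltnSn.
apply: (@leq_trans (2 ^ n + (size ((det_op a c lam)`_(2 ^ n))).-1)).
  exact: leq_addr.
apply: (leq_bigmax_cond (Ordinal sz)) => /=.
by rewrite det_op_lead oner_neq0.
Qed.

(** Comparison at the entry of largest modulus of a kernel vector, as in
    Gershgorin's theorem; no sharp constant is sought, so the sum of all
    [`|Lambda_mx lam i j|] serves as the half-width of the strip. *)
Lemma hyperbolic_det_op : hyperbolic (det_op a c lam).
Proof.
split; first by rewrite op_order_det_op det_op_lead coef1 oner_neq0.
pose K := \sum_i \sum_j `|Lambda_mx lam i j|.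
exists K => xi tau.
(* Evaluation is a ring morphism, so it commutes with the determinant. *)
pose ev (Q : {poly {poly R}}) : R[i] :=
  (map_poly (map_poly (real_complex R)) Q).[tau, Complex 0 xi].
have evM : monoid_morphism ev.
  by split; [rewrite /ev !rmorph1 !hornerC|
    move=> x y; rewrite /ev rmorphM/= !hornerM].
have evA : zmod_morphism ev.
  by move=> x y; rewrite /ev rmorphB/= !hornerE.
pose m1 := GRing.isZmodMorphism.Build _ _ ev evA.
pose m2 := GRing.isMonoidMorphism.Build _ _ ev evM.
pose evm : {rmorphism {poly {poly R}} -> R[i]} := HB.pack ev m1 m2.
rewrite -/(ev _) -[ev _]/(evm _) -[det_op _ _ _]/(\det op_mx) -det_map_mx.
move/eqP/det0P => [v vn0 v0].
have e0 : exists k, v 0 k != 0.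
  apply/existsP; apply: contra_neqT vn0; rewrite negb_exists => /forallP h.
  by apply/rowP => k; rewrite mxE; apply/eqP; rewrite -[_ == _]negbK h.
case: e0 => k0 vk0.
pose nc (z : R[i]) := complex.Re `|z|.
have ncE z : `|z| = (nc z)%:C%C.
  by rewrite /nc normc_def.
have [k kmax] : exists k, forall i, nc (v 0 i) <= nc (v 0 k).
  have := arg_maxP (fun i => nc (v 0 i)) (isT : xpredT k0).
  case=> k _ h; exists k => i; exact: h.
have vk : 0 < nc (v 0 k).
  apply: lt_le_trans (kmax k0).
  by have := vk0; rewrite -normr_gt0 ncE -ltcR.
(* The equation of column [k], where [v 0 k] has the largest modulus. *)
have /rowP/(_ k) := v0; rewrite !mxE.
under eq_bigr => i _ do rewrite mxE op_mxE raddfD/= mulrDr.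
rewrite big_split/= (bigD1 k)//= eqxx big1 => [|i /negPf->]; last first.
  by rewrite -[ev 0]/(evm 0) rmorph0 mulr0.
rewrite addr0 => /eqP; rewrite addr_eq0 => /eqP e.
have {}e : nc (v 0 k) * nc (ev ('X + (drift k *: 'X)%:P)) <=
    nc (v 0 k) * K.
  rewrite -lecR !rmorphM/= -!ncE -normrM e normrN.
  apply: le_trans (ler_norm_sum _ _ _) _.
  apply: (@le_trans _ _ (\sum_i (nc (v 0 k))%:C%C * `|Lambda_mx lam i k|%:C%C)).
    apply: ler_sum => i _; rewrite normrM.
    have -> : ev (Lambda_mx lam i k)%:P%:P = (Lambda_mx lam i k)%:C%C.
      by rewrite /ev map_polyC/= hornerC map_polyC/= hornerC.
    have -> : `|(Lambda_mx lam i k)%:C%C| = `|Lambda_mx lam i k|%:C%C.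
      by rewrite normc_def/= expr0n addr0 sqrtr_sqr.
    rewrite ler_wpM2r//; first by rewrite lecR.
    by rewrite ncE lecR kmax.
  rewrite -mulr_sumr ncE -rmorph_sum -!rmorphM/= lecR.
  rewrite ler_wpM2l ?(ltW vk)//; apply: ler_sum => i _.
  by rewrite (bigD1 k)//= lerDl sumr_ge0.
rewrite ler_pM2l// in e.
apply: le_trans e.
have -> : ev ('X + (drift k *: 'X)%:P) = tau + Complex 0 (drift k * xi).
  rewrite /ev rmorphD/= map_polyX map_polyC/= map_polyZ/= map_polyX !hornerE.
  congr (_ + _); apply/eqP; rewrite eq_complex/= mulr0 !mul0r subrr addr0.
  by rewrite !eqxx.
rewrite /nc; case: tau @ev evM evA m1 m2 evm v0 => x y /= *.
rewrite addr0 -sqrtr_sqr ler_sqrt ?lerDl ?sqr_ge0//.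
by rewrite addr_ge0 ?sqr_ge0.
Qed.

End Algebra.

(** * Differential calculus in the plane *)

Section OneVariable.
Variable R : realType.
Implicit Types (g dg : R -> R).

Lemma mean_value g dg (a b : R) : (forall x : R, is_derive x 1 g (dg x)) ->
  a <= b -> exists2 c, a <= c <= b & g b - g a = dg c * (b - a).
Proof.
move=> hg ab; have [|c] := @MVT_segment R g dg a b ab (fun x _ => hg x).
  by apply: derivable_within_continuous => x _; have [] := hg x.
by rewrite in_itv /= => cab e; exists c.
Qed.

Lemma lipschitz_of_derive g dg (M : R) :
  (forall x : R, is_derive x 1 g (dg x)) -> (forall x, `|dg x| <= M) ->
  forall a b, `|g b - g a| <= M * `|b - a|.
Proof.
move=> hg hM a b; wlog ab : a b / a <= b.
  move=> H; have /orP[] := le_total a b; first exact: H.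
  by move=> /H; rewrite distrC [in X in _ <= X]distrC.
have [c _ ->] := mean_value hg ab.
by rewrite normrM ler_wpM2r.
Qed.

Lemma taylor_order1 g dg ddg (M : R) :
  (forall x : R, is_derive x 1 g (dg x)) ->
  (forall x : R, is_derive x 1 dg (ddg x)) -> (forall x, `|ddg x| <= M) ->
  forall a b, `|g b - g a - dg a * (b - a)| <= M * `|b - a| ^+ 2.
Proof.
move=> hg hdg hM a b.
have M0 : 0 <= M by apply: le_trans (hM a).
have key c : `|c - a| <= `|b - a| ->
    `|dg c * (b - a) - dg a * (b - a)| <= M * `|b - a| ^+ 2.
  move=> cab; rewrite -mulrBl normrM expr2 mulrA ler_wpM2r//.
  by apply: (le_trans (lipschitz_of_derive hdg hM _ _)); rewrite ler_wpM2l.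
have [ab|ab] := leP a b.
  have [c /andP[ac cb] ->] := mean_value hg ab; apply: key.
  by rewrite !ger0_norm ?subr_ge0// lerB.
have [c /andP[ac cb] e] := mean_value hg (ltW ab).
have -> : g b - g a = dg c * (b - a) by rewrite -opprB e -mulrN opprB.
apply: key; rewrite !ler0_norm ?subr_le0 ?(ltW ab)// ?opprB ?lerB//.
Qed.

End OneVariable.

Section SmoothPlane.
Variable R : realType.
Implicit Types (f g : R * R -> R) (s : seq bool).

Lemma is_derive_dx f (x t : R) : derivable f (x, t) (1, 0) ->
  is_derive x 1 (fun y => f (y, t)) (dx f (x, t)).
Proof.
have e : (fun h : R => h^-1 *: (((fun y => f (y, t)) \o shift x) (h *: 1) - f (x, t)))
  = (fun h => h^-1 *: ((f \o shift (x, t)) (h *: ((1 : R), (0 : R))) - f (x, t))).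
  apply/funext => h /=; congr (_ *: (f _ - _)).
  by apply: injective_projections => /=; rewrite ?scaler0 ?add0r.
by move=> hf; split; rewrite /dx /derivable /derive e.
Qed.

Lemma is_derive_dt f (x t : R) : derivable f (x, t) (0, 1) ->
  is_derive t 1 (fun y => f (x, y)) (dt f (x, t)).
Proof.
have e : (fun h : R => h^-1 *: (((fun y => f (x, y)) \o shift t) (h *: 1) - f (x, t)))
  = (fun h => h^-1 *: ((f \o shift (x, t)) (h *: ((0 : R), (1 : R))) - f (x, t))).
  apply/funext => h /=; congr (_ *: (f _ - _)).
  by apply: injective_projections => /=; rewrite ?scaler0 ?add0r.
by move=> hf; split; rewrite /dt /derivable /derive e.
Qed.

Lemma smooth2_partials s f : smooth2 f -> smooth2 (partials s f).
Proof.
move=> hf s'.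
have -> : partials s' (partials s f) = partials (s' ++ s) f.
  by rewrite /partials foldr_cat.
exact: hf.
Qed.

Lemma smooth2_dx f : smooth2 f -> smooth2 (dx f).
Proof. exact: (@smooth2_partials [:: false]). Qed.

Lemma smooth2_dt f : smooth2 f -> smooth2 (dt f).
Proof. exact: (@smooth2_partials [:: true]). Qed.

Lemma smooth2_is_derive_dx f : smooth2 f ->
  forall t x : R, is_derive x 1 (fun y => f (y, t)) (dx f (x, t)).
Proof. by move=> hf t x; apply: is_derive_dx; exact: ((hf [::]).2 (x, t)).1. Qed.

Lemma smooth2_is_derive_dt f : smooth2 f ->
  forall x t : R, is_derive t 1 (fun y => f (x, y)) (dt f (x, t)).
Proof. by move=> hf x t; apply: is_derive_dt; exact: ((hf [::]).2 (x, t)).2. Qed.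

Lemma smooth2_continuous f : smooth2 f -> continuous f.
Proof. by move=> /(_ [::])[]. Qed.

(** Continuity at the lower left corner of a box, in the form that matches a
    pair of applications of the mean value theorem. *)
Lemma continuous_box f z (e : R) : continuous f -> 0 < e ->
  exists2 h : R, 0 < h & forall x t,
    z.1 <= x <= z.1 + h -> z.2 <= t <= z.2 + h -> `|f z - f (x, t)| < e.
Proof.
move=> cf e0; have /cvgrPdist_lt/(_ e e0) := cf z.
move=> /nbhs_ballP[r /= r0 hr]; exists (r / 2); first by rewrite divr_gt0.
move=> x t hx ht; apply: hr; split; rewrite /ball/= ltr_distl; lra.
Qed.

(** The mixed second difference of [f] over a square with corner [z] is, by two
    applications of the mean value theorem in either order, the area times a
    value of [dt (dx f)] and also the area times a value of [dx (dt f)] in that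
    square; shrinking the square and using continuity identifies both at
    [z]. *)
Lemma dx_dt f : smooth2 f -> dx (dt f) = dt (dx f).
Proof.
move=> hf; apply/funext => z.
apply/eqP; rewrite -subr_eq0 -normr_le0; apply/ler_addgt0Pl => e e0.
rewrite addr0.
have e2 : 0 < e / 2 by rewrite divr_gt0.
have [h1 h10 H1] := continuous_box z
  (smooth2_continuous (smooth2_dx (smooth2_dt hf))) e2.
have [h2 h20 H2] := continuous_box z
  (smooth2_continuous (smooth2_dt (smooth2_dx hf))) e2.
pose h := Num.min h1 h2.
have h0 : 0 < h by rewrite lt_min h10.
have hh1 : h <= h1 by rewrite ge_min lexx.
have hh2 : h <= h2 by rewrite ge_min lexx orbT.
case: z H1 H2 => x t /= H1 H2.
have xh : x <= x + h by rewrite lerDl ltW.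
have th : t <= t + h by rewrite lerDl ltW.
have [p1 hp1 e1] := @mean_value R (fun y => f (y, t + h) - f (y, t))
  (fun y => dx f (y, t + h) - dx f (y, t)) x (x + h)
  (fun y => is_deriveB (smooth2_is_derive_dx hf _ _)
                       (smooth2_is_derive_dx hf _ _)) xh.
have [q1 hq1 e1'] := @mean_value R (fun y => dx f (p1, y))
  (fun y => dt (dx f) (p1, y)) t (t + h)
  (fun y => smooth2_is_derive_dt (smooth2_dx hf) _ _) th.
have [q2 hq2 e3] := @mean_value R (fun y => f (x + h, y) - f (x, y))
  (fun y => dt f (x + h, y) - dt f (x, y)) t (t + h)
  (fun y => is_deriveB (smooth2_is_derive_dt hf _ _)
                       (smooth2_is_derive_dt hf _ _)) th.
have [p2 hp2 e3'] := @mean_value R (fun y => dt f (y, q2))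
  (fun y => dx (dt f) (y, q2)) x (x + h)
  (fun y => smooth2_is_derive_dx (smooth2_dt hf) _ _) xh.
have eqd : dx (dt f) (p2, q2) = dt (dx f) (p1, q1).
  have hn : h * h != 0 by rewrite mulf_neq0 ?gt_eqF.
  apply: (mulIf hn).
  have dh (y : R) : y + h - y = h by rewrite (addrC y) addrK.
  move: e1 e1' e3 e3'; rewrite !dh => e1 e1' e3 e3'.
  have E1 := etrans e1 (congr1 (fun y => y * h) e1').
  have E3 := etrans e3 (congr1 (fun y => y * h) e3').
  move: E1 E3; cbv beta; clear.
  move: (f (x + h, t + h)) (f (x + h, t)) (f (x, t + h)) (f (x, t)).
  move: (dx (dt f) (p2, q2)) (dt (dx f) (p1, q1)) => u1 u2 A B C D E1 E3.
  by rewrite !mulrA -E1 -E3; ring.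
have := H1 p2 q2; have := H2 p1 q1.
rewrite eqd; set u := dt (dx f) (p1, q1).
have [/andP[a1 a2] /andP[a3 a4] /andP[a5 a6] /andP[a7 a8]] :=
  And4 hp1 hq1 hp2 hq2.
move=> K2 K1.
have {}K2 : `|dt (dx f) (x, t) - u| < e / 2.
  by apply: K2; rewrite ?a1 ?a3 /=; [apply: le_trans a2 _|apply: le_trans a4 _];
    rewrite lerD2l.
have {}K1 : `|dx (dt f) (x, t) - u| < e / 2.
  by apply: K1; rewrite ?a5 ?a7 /=; [apply: le_trans a6 _|apply: le_trans a8 _];
    rewrite lerD2l.
move: K1 K2; clear; move: (dx (dt f) (x, t)) (dt (dx f) (x, t)) => p q.
rewrite !ltr_distl => /andP[b1 b2] /andP[b3 b4].
by rewrite ler_distl; apply/andP; split; lra.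
Qed.

(** The increment is split along one horizontal and one vertical segment, so
    only one-variable expansions and the Lipschitz property of [dx f] in time
    are needed, not the differentiability of [f]. *)
Lemma taylor2 f (M : R) : smooth2 f ->
  (forall s z, size s = 2%N -> `|partials s f z| <= M) ->
  forall x t a b,
  `|f (x + a, t + b) - f (x, t) - (a * dx f (x, t) + b * dt f (x, t))|
     <= M * (`|a| + `|b|) ^+ 2.
Proof.
move=> hf hM x t a b.
have M0 : 0 <= M by apply: le_trans (hM [:: true; true] (x, t) erefl).
have A := taylor_order1 (smooth2_is_derive_dx hf (t + b))
  (smooth2_is_derive_dx (smooth2_dx hf) (t + b))
  (fun y => hM [:: false; false] _ erefl) x (x + a).
have B := taylor_order1 (smooth2_is_derive_dt hf x)
  (smooth2_is_derive_dt (smooth2_dt hf) x)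
  (fun y => hM [:: true; true] _ erefl) t (t + b).
have C := lipschitz_of_derive (smooth2_is_derive_dt (smooth2_dx hf) x)
  (fun y => hM [:: true; false] _ erefl) t (t + b).
rewrite (addrC x) addrK in A; rewrite (addrC t) addrK in B.
rewrite (addrC t) addrK in C. rewrite (addrC t) in A.
rewrite (addrC x) (addrC t).
set u := f (a + x, b + t) in A *; set v := f (x, b + t) in A B *.
set w := dx f (x, b + t) in A C *.
have -> : u - f (x, t) - (a * dx f (x, t) + b * dt f (x, t)) =
  (u - v - w * a) + (v - f (x, t) - dt f (x, t) * b) + (w - dx f (x, t)) * a.
  by ring.
apply: le_trans (ler_normD _ _) _.
apply: le_trans (lerD (le_trans (ler_normD _ _) (lerD A B))
  (_ : _ <= M * `|b| * `|a|)) _.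
  by rewrite normrM ler_wpM2r.
have := normr_ge0 a; have := normr_ge0 b.
move: `|a| `|b| => p q q0 p0.
have pq : 0 <= M * (p * q) by rewrite !mulr_ge0.
nra.
Qed.

Lemma lipschitz2 f (M : R) : smooth2 f ->
  (forall s z, size s = 1%N -> `|partials s f z| <= M) ->
  forall x t a b : R, `|f (x + a, t + b) - f (x, t)| <= M * (`|a| + `|b|).
Proof.
move=> hf hM x t a b.
have A := lipschitz_of_derive (smooth2_is_derive_dx hf (t + b))
  (fun y => hM [:: false] _ erefl) x (x + a).
have B := lipschitz_of_derive (smooth2_is_derive_dt hf x)
  (fun y => hM [:: true] _ erefl) t (t + b).
rewrite (addrC x) addrK (addrC t) in A; rewrite (addrC t) addrK in B.
rewrite (addrC x) (addrC t) mulrDr.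
have -> : f (a + x, b + t) - f (x, t) =
  (f (a + x, b + t) - f (x, b + t)) + (f (x, b + t) - f (x, t)).
  by rewrite addrA subrK.
exact: le_trans (ler_normD _ _) (lerD A B).
Qed.

Lemma smooth2_slice_continuous f (a t : R) : smooth2 f ->
  continuous (fun x => f (x + a, t)).
Proof.
move=> hf x.
have c : continuous (fun y => f (y, t)).
  move=> y; apply: differentiable_continuous; apply/derivable1_diffP.
  by have [] := smooth2_is_derive_dx hf t y.
apply: (cvg_comp _ (fun y => f (y, t)) _ (c (x + a))).
by apply: cvgD; [exact: cvg_id|exact: cvg_cst].
Qed.

End SmoothPlane.

(** * Test functions and adjoint operators *)

Section TestClosure.
Variable R : realType.
Implicit Types (f g : R * R -> R) (s : seq bool) (P Q : {poly {poly R}}).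

Lemma derivable_comb f g (k : R) z v : derivable f z v -> derivable g z v ->
  derivable (fun y => f y + k * g y) z v.
Proof. by move=> df dg; exact: (derivableD df (@derivableZ _ _ _ g k z v dg)). Qed.

Lemma derive_comb f g (k : R) z v : derivable f z v -> derivable g z v ->
  'D_v (fun y => f y + k * g y) z = 'D_v f z + k * 'D_v g z.
Proof.
move=> df dg; have := deriveD df (@derivableZ _ _ _ g k z v dg).
by rewrite (@deriveZ _ _ _ g k z v dg).
Qed.

Lemma partials_comb s f g k : smooth2 f -> smooth2 g ->
  partials s (fun z => f z + k * g z) =
  (fun z => partials s f z + k * partials s g z).
Proof.
move=> hf hg; elim: s => [//|b s IHs].
rewrite [LHS]/= IHs; apply/funext => z.
have [_ /(_ z)[f1 f2]] := hf s; have [_ /(_ z)[g1 g2]] := hg s.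
by case: b; [exact: (@derive_comb (partials s f) (partials s g) k z _ f2 g2)|
  exact: (@derive_comb (partials s f) (partials s g) k z _ f1 g1)].
Qed.

Lemma partials_cst0 s : partials s (fun=> 0 : R) = (fun=> 0).
Proof.
elim: s => [//|b s /= ->].
by case: b; apply/funext => z; [apply: derive_cst|apply: derive_cst].
Qed.

Lemma smooth2_comb f g k : smooth2 f -> smooth2 g ->
  smooth2 (fun z => f z + k * g z).
Proof.
move=> hf hg s; rewrite partials_comb//; split.
  move=> z; apply: cvgD; first exact: (hf s).1.
  by apply: cvgMr; exact: (hg s).1.
move=> z; have [_ /(_ z)[f1 f2]] := hf s; have [_ /(_ z)[g1 g2]] := hg s.
by split; exact: derivable_comb.
Qed.

Lemma test_function0 : test_function (fun=> 0 : R).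
Proof.
split.
- move=> s; rewrite partials_cst0; split; first by move=> z; exact: cvg_cst.
  by move=> z; split; exact: derivable_cst.
- by exists 1, 1.
- by move=> s m; exists 0 => x t; rewrite partials_cst0 normr0 mulr0.
Qed.

Lemma test_function_comb f g k : test_function f -> test_function g ->
  test_function (fun z => f z + k * g z).
Proof.
case=> sf [u0 [u1 [u00 hu]]] bf [sg [v0 [v1 [v00 hv]]] bg]; split.
- exact: smooth2_comb.
- exists (Num.min u0 v0), (Num.max u1 v1); split; first by rewrite lt_min u00.
  move=> x t; rewrite ge_min le_max => h.
  rewrite hu ?hv ?mulr0 ?addr0//; apply: contra h => /andP[-> ->]//;
    by rewrite ?orbT.
- move=> s m; have [M1 h1] := bf s m; have [M2 h2] := bg s m.
  exists (M1 + `|k| * M2) => x t; rewrite partials_comb//.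
  apply: le_trans (ler_wpM2l _ (ler_normD _ _)) _; first exact: exprn_ge0.
  rewrite mulrDr lerD// normrM mulrCA ler_wpM2l//.
Qed.

Lemma test_functionZ k g : test_function g -> test_function (fun z => k * g z).
Proof.
move=> hg; have := test_function_comb k test_function0 hg.
by rewrite [X in test_function X](_ : _ = fun z => k * g z)//; apply/funext => z; rewrite add0r.
Qed.

Lemma test_function_sum (I : Type) (r : seq I) (F : I -> R * R -> R) :
  (forall i, test_function (F i)) -> test_function (fun z => \sum_(i <- r) F i z).
Proof.
move=> hF; elim: r => [|i r IHr].
  under eq_fun do rewrite big_nil; exact: test_function0.
under eq_fun do rewrite big_cons.
have := test_function_comb 1 (hF i) IHr.
by under eq_fun do rewrite mul1r.
Qed.

(** The complement of a closed time strip is open, so [f] vanishes near each of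
    its points. *)
Lemma partials_support (t0 t1 : R) s f :
  (forall x t, ~~ (t0 <= t <= t1) -> f (x, t) = 0) ->
  forall x t, ~~ (t0 <= t <= t1) -> partials s f (x, t) = 0.
Proof.
move=> ht; elim: s => [//|b s IHs] x t htt.
have e : \forall y \near (x, t), partials s f y = (cst 0 : R * R -> R) y.
  have : \forall y \near (x, t), (fun z : R * R => ~~ (t0 <= z.2 <= t1)) y.
    have c2 : (fun z : R * R => z.2) @ (x, t) --> t by exact: cvg_snd.
    move: htt; rewrite negb_and -!ltNge => /orP[] h.
      near=> z; rewrite negb_and -!ltNge; apply/orP; left.
      by near: z; exact: (@cvgr_lt _ _ _ _ _ _ c2 _ h).
    near=> z; rewrite negb_and -!ltNge; apply/orP; right.
    by near: z; exact: (@cvgr_gt _ _ _ _ _ _ c2 _ h).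
  by apply: filterS => -[y u] /= /IHs.
by case: b => /=; rewrite /dt /dx (near_eq_derive _ e) derive_cst.
Unshelve. all: by end_near. Qed.

Lemma test_function_partials s f : test_function f -> test_function (partials s f).
Proof.
case=> sf [t0 [t1 [t00 ht]]] bf; split.
- exact: smooth2_partials.
- by exists t0, t1; split=> //; exact: partials_support.
- move=> s' m; have [M hM] := bf (s' ++ s) m; exists M => x t.
  by move: (hM x t); rewrite /partials foldr_cat.
Qed.

Lemma test_function_bounded f s : test_function f ->
  exists M : R, forall z, `|partials s f z| <= M.
Proof.
case=> _ _ /(_ s 0%N)[M hM]; exists M => -[x t].
by have := hM x t; rewrite expr0 mul1r.
Qed.

(** One constant for all partial derivatives of order at most [k]; the
    derivative applied first is peeled off, since it turns a test function into
    a test function. *)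
Lemma test_function_bounded_upto k f : test_function f ->
  exists M : R, forall s z, (size s <= k)%N -> `|partials s f z| <= M.
Proof.
elim: k f => [|k IHk] f hf.
  have [M hM] := test_function_bounded [::] hf.
  by exists M => s z; rewrite leqn0 => /nilP ->; exact: hM.
have [M0 h0] := IHk f hf.
have [M1 h1] := IHk _ (test_function_partials [:: false] hf).
have [M2 h2] := IHk _ (test_function_partials [:: true] hf).
exists (Num.max M0 (Num.max M1 M2)) => s z.
case/lastP: s => [|s b] hs; first by rewrite le_max h0.
rewrite size_rcons ltnS in hs.
have -> : partials (rcons s b) f = partials s (partials [:: b] f).
  by rewrite /partials -cats1 foldr_cat.
rewrite !le_max; case: b.
  by apply/orP; right; apply/orP; right; exact: h2.
by apply/orP; right; apply/orP; left; exact: h1.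
Qed.

End TestClosure.

Section Adjoint.
Variable R : realType.
Implicit Types (f g : R * R -> R) (s : seq bool) (P Q : {poly {poly R}}).

(** The normal form in which [adjoint_op] writes its derivatives: all d/dx
    first. *)
Definition monomial i j f := iter i (@dt R) (iter j (@dx R) f).

Lemma monomial_partials i j f :
  monomial i j f = partials (nseq i true ++ nseq j false) f.
Proof.
rewrite /monomial /partials foldr_cat; elim: i => [|i /= ->]//=.
by elim: j => [|j /= ->].
Qed.

Lemma dx_monomial i j f : smooth2 f -> dx (monomial i j f) = monomial i j.+1 f.
Proof.
move=> hf; elim: i => [//|i IHi].
rewrite -[monomial i.+1 j f]/(dt (monomial i j f)) dx_dt; first by rewrite IHi.
by rewrite monomial_partials; exact: smooth2_partials.
Qed.

(** A square of this side contains the indices of all coefficients of [P], so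
    that the adjoints of several operators can be written as sums over a common
    index set. *)
Definition psize P := maxn (size P) (\max_(i < size P) size (P`_i)%R).

Lemma psize_bound P Q : exists K, (psize P <= K)%N /\ (psize Q <= K)%N.
Proof. by exists (maxn (psize P) (psize Q)); rewrite leq_maxl leq_maxr. Qed.

Lemma psize_coef P i j : (psize P <= maxn i j)%N -> P`_i`_j = 0.
Proof.
rewrite leq_max !geq_max => /orP[/andP[h _]|/andP[_ h]].
  by rewrite [P`_i]nth_default ?coef0.
have [hi|hi] := ltnP i (size P); last by rewrite [P`_i]nth_default ?coef0.
rewrite nth_default//; apply: leq_trans h.
exact: (leq_bigmax (Ordinal hi)).
Qed.

Lemma adjoint_opE P f z K : (psize P <= K)%N -> adjoint_op P f z =
  \sum_(i < K) \sum_(j < K) (-1) ^+ (i + j) * P`_i`_j * monomial i j f z.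
Proof.
move=> hK.
pose F i j := (-1) ^+ (i + j) * P`_i`_j * monomial i j f z.
have hs : (size P <= K)%N by apply: leq_trans hK; exact: leq_maxl.
transitivity (\sum_(i < size P) \sum_(j < K) F i j).
  apply: eq_bigr => i _.
  have hi : (size (P`_i)%R <= K)%N.
    apply: leq_trans hK; rewrite leq_max; apply/orP; right.
    exact: (leq_bigmax i).
  rewrite [RHS](bigID (fun j : 'I_K => (j < size (P`_i)%R)%N))/=.
  rewrite [X in _ + X]big1 ?addr0 => [|j]; last first.
    by rewrite -leqNgt /F => hj; rewrite [P`_i`_j]nth_default// mulr0 mul0r.
  by rewrite (big_ord_widen _ (fun j => F i j) hi).
rewrite [RHS](bigID (fun i : 'I_K => (i < size P)%N))/=.
rewrite [X in _ + X]big1 ?addr0 => [|i]; last first.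
  rewrite -leqNgt => hi; rewrite big1// => j _.
  by rewrite [P`_i]nth_default// coef0 mulr0 mul0r.
by rewrite (big_ord_widen _ (fun i => \sum_(j < K) F i j) hs).
Qed.

Lemma adjoint_op_test P f : test_function f -> test_function (adjoint_op P f).
Proof.
move=> hf; apply: test_function_sum => i; apply: test_function_sum => j.
apply: test_functionZ; rewrite -[iter _ _ _]/(monomial i j f).
by rewrite monomial_partials; exact: test_function_partials.
Qed.

Lemma adjoint_op_support P f (t0 t1 : R) :
  (forall x t, ~~ (t0 <= t <= t1) -> f (x, t) = 0) ->
  forall x t, ~~ (t0 <= t <= t1) -> adjoint_op P f (x, t) = 0.
Proof.
move=> hf x t htt; rewrite /adjoint_op big1// => i _; rewrite big1// => j _.
rewrite -[iter _ _ _]/(monomial i j f) monomial_partials.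
by rewrite (partials_support _ hf) ?mulr0.
Qed.

Lemma adjoint_opD P Q f z :
  adjoint_op (P + Q) f z = adjoint_op P f z + adjoint_op Q f z.
Proof.
have [K0 [k1 k2]] := psize_bound P Q.
pose K := maxn K0 (psize (P + Q)).
rewrite (@adjoint_opE (P + Q) f z K) ?leq_maxr//.
rewrite (@adjoint_opE P f z K) ?(leq_trans k1) ?leq_maxl//.
rewrite (@adjoint_opE Q f z K) ?(leq_trans k2) ?leq_maxl// -big_split/=.
apply: eq_bigr => i _; rewrite -big_split/=; apply: eq_bigr => j _.
by rewrite !coefD mulrDr mulrDl.
Qed.

Lemma adjoint_op0 f z : adjoint_op 0 f z = 0.
Proof. by rewrite /adjoint_op size_poly0 big_ord0. Qed.

Lemma adjoint_op_sum (I : Type) (r : seq I) (F : I -> {poly {poly R}}) f z :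
  adjoint_op (\sum_(i <- r) F i) f z = \sum_(i <- r) adjoint_op (F i) f z.
Proof.
elim: r => [|i r IHr]; first by rewrite !big_nil adjoint_op0.
by rewrite !big_cons adjoint_opD IHr.
Qed.

Lemma adjoint_opZ (r : R) P f z :
  adjoint_op (r%:P%:P * P) f z = r * adjoint_op P f z.
Proof.
have [K [k1 k2]] := psize_bound (r%:P%:P * P) P.
rewrite (adjoint_opE f z k1) (adjoint_opE f z k2) mulr_sumr.
apply: eq_bigr => i _; rewrite mulr_sumr; apply: eq_bigr => j _.
by rewrite !coefCM; ring.
Qed.

Lemma derive_sum_fun (I : Type) (r : seq I) (F : I -> R * R -> R) z v :
  (forall i, derivable (F i) z v) ->
  'D_v (fun y => \sum_(i <- r) F i y) z = \sum_(i <- r) 'D_v (F i) z /\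
  derivable (fun y => \sum_(i <- r) F i y) z v.
Proof.
move=> hF; elim: r => [|i r [IHr IHd]].
  under eq_fun do rewrite big_nil; rewrite big_nil.
  by split; [exact: derive_cst|exact: derivable_cst].
under eq_fun do rewrite big_cons; rewrite big_cons -IHr.
by split; [exact: (deriveD (hF i) IHd)|exact: (derivableD (hF i) IHd)].
Qed.

Lemma derive_adjoint P f z v K : (psize P <= K)%N ->
  (forall i j, derivable (monomial i j f) z v) ->
  'D_v (adjoint_op P f) z =
  \sum_(i < K) \sum_(j < K) (-1) ^+ (i + j) * P`_i`_j * 'D_v (monomial i j f) z.
Proof.
move=> hK hd.
have -> : adjoint_op P f = fun y =>
    \sum_(i < K) \sum_(j < K) (-1) ^+ (i + j) * P`_i`_j * monomial i j f y.
  by apply/funext => y; exact: adjoint_opE.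
have hd' i j : derivable (fun y => (-1) ^+ (i + j) * P`_i`_j * monomial i j f y) z v.
  exact: derivableZ.
pose F (i j : 'I_K) y := (-1) ^+ (i + j) * P`_i`_j * monomial i j f y.
have A (i : 'I_K) :=
  @derive_sum_fun _ (index_enum 'I_K) (F i) z v (fun j => hd' i j).
have [B _] := @derive_sum_fun _ (index_enum 'I_K)
  (fun i y => \sum_(j < K) F i j y) z v (fun i => (A i).2).
rewrite [LHS]B; apply: eq_bigr => i _; rewrite (A i).1.
by apply: eq_bigr => j _; exact: deriveZ.
Qed.

(** Each factor d/dt contributes one integration by parts, hence the sign. *)
Lemma adjoint_op_Xt P f z : smooth2 f ->
  adjoint_op ('X * P) f z = - dt (adjoint_op P f) z.
Proof.
move=> hf; have [K [k1 k2]] := psize_bound ('X * P) P.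
rewrite /dt (derive_adjoint k2); last first.
  by move=> i j; rewrite monomial_partials; exact: ((hf _).2 z).2.
rewrite (adjoint_opE f z (leqW k1)).
rewrite big_ord_recl/= big1 => [|j _]; last first.
  by rewrite coefXM/= coef0 mulr0 mul0r.
rewrite add0r -sumrN; apply: eq_bigr => i _.
rewrite big_ord_recr/= coefXM/= [P`_i`_K]psize_coef; last first.
  by apply: leq_trans k2 _; exact: leq_maxr.
rewrite mulr0 mul0r addr0 -sumrN; apply: eq_bigr => j _.
by rewrite /bump addSn exprS !mulN1r !mulNr.
Qed.

(** The new d/dx is outermost and has to be moved inside all the d/dt, which is
    where [dx_monomial], hence the symmetry of second derivatives, enters. *)
Lemma adjoint_op_Xx P f z : smooth2 f ->
  adjoint_op ('X%:P * P) f z = - dx (adjoint_op P f) z.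
Proof.
move=> hf; have [K [k1 k2]] := psize_bound ('X%:P * P) P.
rewrite /dx (derive_adjoint k2); last first.
  by move=> i j; rewrite monomial_partials; exact: ((hf _).2 z).1.
rewrite (adjoint_opE f z (leqW k1)).
rewrite big_ord_recr/= [X in _ + X]big1 ?addr0 => [|j _]; last first.
  rewrite coefCM coefXM; case: eqP => _; first by rewrite mulr0 mul0r.
  rewrite psize_coef ?mulr0 ?mul0r//; apply: leq_trans k2 _; exact: leq_maxl.
rewrite -sumrN; apply: eq_bigr => i _.
rewrite big_ord_recl/= coefCM coefXM/= mulr0 mul0r add0r.
rewrite -sumrN; apply: eq_bigr => j _.
rewrite coefXM/= -[derive _ _ _]/(dx (monomial i j f) z).
by rewrite dx_monomial// /bump addnS exprS !mulN1r !mulNr.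
Qed.

End Adjoint.

(** The adjoint of an entry of [op_mx], of first order, composed with that of
    an arbitrary operator. *)
Lemma adjoint_op_mx (R : realType) (n : nat) (a c lam : 'I_n -> R)
    (k m : 'I_(2 ^ n)) (Q : {poly {poly R}}) (f : R * R -> R) z : smooth2 f ->
  adjoint_op (op_mx a c lam k m * Q) f z =
  (if k == m then - dt (adjoint_op Q f) z - drift a c k * dx (adjoint_op Q f) z
   else 0) + Lambda_mx lam k m * adjoint_op Q f z.
Proof.
move=> sf; rewrite op_mxE mulrDl adjoint_opD adjoint_opZ; congr (_ + _).
case: eqP => [->|_]; last by rewrite mul0r adjoint_op0.
rewrite mulrDl adjoint_opD adjoint_op_Xt// -mul_polyC polyCM -mulrA.
by rewrite adjoint_opZ adjoint_op_Xx// mulrN.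
Qed.

(** * Integrals of piecewise constant sign paths *)

Section Path.
Variable R : realType.
Notation leb := (@lebesgue_measure R).

Lemma norm_Rintegral_itv_le (f : R -> R) (M s t : R) : s <= t -> 0 <= M ->
  measurable_fun `]s, t] f -> (forall x, s < x <= t -> `|f x| <= M) ->
  `|\int[leb]_(x in `]s, t]) f x| <= M * (t - s).
Proof.
move=> st M0 mf bf.
have fin : leb `]s, t] = (t - s)%:E.
  rewrite lebesgue_measure_itv/= lte_fin; case: ltgtP st => // -> _.
  by rewrite subrr.
have finy : (leb `]s, t] < +oo)%E by rewrite fin ltry.
have intf : leb.-integrable `]s, t] (EFin \o f).
  apply: measurable_bounded_integrable => //.
  exists M; split; first exact: num_real.
  move=> x Mx y /=; rewrite in_itv/= => yst.
  by apply: le_trans (ltW Mx); exact: bf.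
have intc : leb.-integrable `]s, t] (EFin \o cst M).
  apply: measurable_bounded_integrable => //.
  exists M; split; first exact: num_real.
  by move=> x Mx y /= _; rewrite ger0_norm// ltW.
apply: le_trans (le_normr_Rintegral _ intf) _ => //.
apply: (@le_trans _ _ (\int[leb]_(x in `]s, t]) M)).
  by apply: le_Rintegral => //; exact: (integrable_norm intf).
by rewrite (@Rintegral_cst _ _ _ leb)//= [X in fine X]fin.
Qed.

Variables (d0 : R) (N : R -> nat).
Hypothesis d0_sign : d0 = -1 \/ d0 = 1.
Hypothesis N_mono : forall s t : R, 0 <= s -> s <= t -> (N s <= N t)%N.

Let D (t : R) : R := d0 * (-1) ^+ N t.
Let I (t : R) := \int[leb]_(s in `[0, t]) D s.

Lemma abs_sign_path t : `|D t| = 1.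
Proof.
rewrite /D normrM normrX normrN1 expr1n mulr1.
by case: d0_sign => ->; rewrite ?normrN1 ?normr1.
Qed.

(** [N] is monotone on the half-line only; composing it with the maximum with 0
    makes it monotone on the whole line, and a sign path is a function of that
    integer. *)
Lemma measurable_sign_path (A : set R) : measurable A ->
  A `<=` [set t | 0 <= t] -> measurable_fun A D.
Proof.
move=> mA A0.
(* Agrees with [N] on [A]. *)
pose N' r := N (Num.max r 0).
have mN : measurable_fun setT N'.
  move=> _ Y _; rewrite setTI.
  have -> : N' @^-1` Y = (fun r => (N' r)%:R : R) @^-1` [set n%:R | n in Y].
    apply/seteqP; split=> [r Yr|r [n Yn /eqP]]; first by exists (N' r).
    by rewrite eqr_nat => /eqP e; rewrite /preimage/= -e.
  rewrite -[_ @^-1` _]setTI; apply: nondecreasing_measurable => //.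
    move=> r s rs; rewrite ler_nat; apply: N_mono.
      by rewrite le_max lexx orbT.
    by rewrite ge_max !le_max rs/= lexx orbT.
  apply: countable_measurable; first by move=> r; exact: measurable_set1.
  by apply: sub_countable (countableP Y); exact: card_image_le.
apply: (@eq_measurable_fun _ _ _ _ _ (fun r => d0 * (-1) ^+ N' r)).
  move=> r /set_mem/A0 /= r0; rewrite /D /N'; congr (_ * _ ^+ N _).
  exact/max_idPl.
apply: measurable_funTS.
by apply: (@measurableT_comp _ _ _ _ _ _ (fun n : nat => d0 * (-1) ^+ n)).
Qed.

Lemma sign_integralB (s t : R) : 0 <= s -> s <= t ->
  I t - I s = \int[leb]_(x in `]s, t]) D x.
Proof.
move=> s0 st; apply: Rintegral_itvB; rewrite ?bnd_simp//.
have t0 := le_trans s0 st.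
have finy : (leb `[0%R, t] < +oo)%E.
  by rewrite lebesgue_measure_itv/= lte_fin; case: ifP; rewrite ?ltry.
apply: measurable_bounded_integrable => //.
- by apply: measurable_sign_path => // x /=; rewrite in_itv/= => /andP[].
- exists 1; split; first exact: num_real.
  by move=> x x1 y _; rewrite /= abs_sign_path ltW.
Qed.

Let mD (s t : R) : 0 <= s -> measurable_fun `]s, t] D.
Proof.
move=> s0; apply: measurable_sign_path => // x /=; rewrite in_itv/=.
by move=> /andP[sx _]; rewrite (le_trans s0)// ltW.
Qed.

Lemma sign_integral_lip (s t : R) : 0 <= s -> s <= t -> `|I t - I s| <= t - s.
Proof.
move=> s0 st; rewrite sign_integralB// -[leRHS]mul1r.
have b1 x : s < x <= t -> `|D x| <= 1 by rewrite abs_sign_path.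
exact: (norm_Rintegral_itv_le st ler01 (@mD s t s0) b1).
Qed.

Lemma sign_integral_const (s t : R) : 0 <= s -> s <= t -> N s = N t ->
  I t - I s = (t - s) * D s.
Proof.
move=> s0 st e; rewrite sign_integralB//.
rewrite (@eq_Rintegral _ _ _ _ _ (cst (D s))); last first.
  move=> x /[!inE]/=; rewrite in_itv/= => /andP[sx xt]; rewrite /D.
  have x0 : 0 <= x by apply: le_trans (ltW sx).
  congr (_ * _ ^+ _); apply/eqP; rewrite eqn_leq (N_mono s0 (ltW sx)) andbT.
  by rewrite e N_mono.
rewrite /cst Rintegral_cst//= lebesgue_measure_itv/= lte_fin mulrC.
case: ltgtP st => // -> _.
by rewrite subrr.
Qed.

(** The step is exact if there is no jump in between; otherwise the error is at
    most twice the length of the step and there is at least one jump. *)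
Lemma sign_integral_step (s t : R) : 0 <= s -> s <= t ->
  `|I t - I s - (t - s) * D s| <= 2 * (t - s) * (N t - N s)%:R.
Proof.
move=> s0 st.
have := N_mono s0 st; rewrite leq_eqVlt => /orP[/eqP e|lt].
  by rewrite sign_integral_const// subrr normr0 e subnn mulr0.
apply: (@le_trans _ _ (2 * (t - s))).
  rewrite mulr_natl mulr2n; apply: le_trans (ler_normB _ _) _.
  rewrite lerD ?sign_integral_lip// normrM abs_sign_path mulr1.
  by rewrite ger0_norm ?subr_ge0.
rewrite ler_peMr ?mulr_ge0 ?subr_ge0//.
by rewrite ler1n subn_gt0.
Qed.

(** Left Riemann sum with [m.+1] steps; the offset keeps the mesh well defined
    for [m = 0]. *)
Definition riemann m (t : R) := \sum_(i < m.+1) t / m.+1%:R * D (i%:R * (t / m.+1%:R)).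

(** Only the steps that contain a jump contribute, and there are at most [N t]
    of them. *)
Lemma riemann_error m (t : R) : 0 <= t ->
  `|I t - riemann m t| <= 2 * (t / m.+1%:R) * (N t)%:R.
Proof.
move=> t0; pose h := t / m.+1%:R; rewrite -/h.
have h0 : 0 <= h by rewrite divr_ge0.
have key k : `|I (k%:R * h) - \sum_(i < k) h * D (i%:R * h)|
    <= 2 * h * (N (k%:R * h) - N 0)%:R.
  elim: k => [|k IHk].
    by rewrite big_ord0 mul0r subnn mulr0 subr0 /I set_itv1 Rintegral_set1 normr0.
  have k0 : 0 <= k%:R * h by rewrite mulr_ge0.
  have kk : k%:R * h <= k.+1%:R * h by rewrite ler_wpM2r// ler_nat.
  have := sign_integral_step k0 kk.
  have -> : k.+1%:R * h - k%:R * h = h by rewrite -mulrBl -natrB// subSnn mul1r.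
  have -> : (N (k.+1%:R * h) - N 0 = (N (k%:R * h) - N 0) +
      (N (k.+1%:R * h) - N (k%:R * h)))%N.
    by rewrite addnC addnBA ?N_mono// subnK// N_mono.
  rewrite natrD mulrDr big_ord_recr/= => step.
  have -> : I (k.+1%:R * h) - (\sum_(i < k) h * D (i%:R * h) + h * D (k%:R * h)) =
     (I (k%:R * h) - \sum_(i < k) h * D (i%:R * h)) +
     (I (k.+1%:R * h) - I (k%:R * h) - h * D (k%:R * h)) by ring.
  exact: le_trans (ler_normD _ _) (lerD IHk step).
have e : m.+1%:R * h = t by rewrite /h mulrC divfK.
have := key m.+1; rewrite e => /le_trans; apply.
by rewrite ler_wpM2l ?mulr_ge0// ler_nat leq_subr.
Qed.

Lemma riemann_cvg (t : R) : 0 <= t -> riemann ^~ t @ \oo --> I t.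
Proof.
move=> t0; apply/cvgrPdist_le => e e0.
have c : (fun m => 2 * (t / m.+1%:R) * (N t)%:R) @ \oo --> (2 * (t * 0) * (N t)%:R : R).
  apply: cvgMl; apply: cvgMr; apply: cvgMr; exact: cvg_harmonic.
rewrite !(mulr0, mul0r) in c.
move/cvgrPdist_le : c => /(_ e e0); apply: filterS => m.
rewrite sub0r normrN => h; apply: le_trans (riemann_error m t0) _.
exact: le_trans (ler_norm _) h.
Qed.

End Path.

(** * Expectation of bounded random variables *)

Section Expectation.
Context (R : realType) (d : measure_display) (T : measurableType d).
Variable P : probability T R.
Implicit Types f g : T -> R.

(** On a probability space these functions are integrable and stable under all
    the operations used below, which spares integrability side conditions. *)
Definition bounded_rv f :=
  measurable_fun setT f /\ exists M : R, forall w, `|f w| <= M.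

Definition expect f : R := \int[P]_w f w.

Lemma bounded_rv_integrable f : bounded_rv f ->
  P.-integrable setT (EFin \o f).
Proof.
case=> mf [M hM].
have finy : (P setT < +oo)%E by rewrite probability_setT ltry.
apply: measurable_bounded_integrable => //.
exists M; split; first exact: num_real.
by move=> x Mx w _ /=; apply: le_trans (ltW Mx).
Qed.

Lemma bounded_rv_cst (r : R) : bounded_rv (fun=> r).
Proof. by split; [exact: measurable_cst|exists `|r|]. Qed.

Lemma bounded_rvD f g : bounded_rv f -> bounded_rv g ->
  bounded_rv (fun w => f w + g w).
Proof.
move=> [mf [M hM]] [mg [K hK]]; split; first exact: measurable_funD.
by exists (M + K) => w; apply: le_trans (ler_normD _ _) _; rewrite lerD.
Qed.

Lemma bounded_rvM f g : bounded_rv f -> bounded_rv g ->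
  bounded_rv (fun w => f w * g w).
Proof.
move=> [mf [M hM]] [mg [K hK]]; split; first exact: measurable_funM.
by exists (M * K) => w; rewrite normrM ler_pM.
Qed.

Lemma bounded_rvZ (r : R) f : bounded_rv f -> bounded_rv (fun w => r * f w).
Proof. exact: bounded_rvM (bounded_rv_cst r). Qed.

Lemma bounded_rvB f g : bounded_rv f -> bounded_rv g ->
  bounded_rv (fun w => f w - g w).
Proof.
move=> bf bg; have := bounded_rvD bf (bounded_rvZ (-1) bg).
by under eq_fun do rewrite mulN1r.
Qed.

Lemma bounded_rv_norm f : bounded_rv f -> bounded_rv (fun w => `|f w|).
Proof.
move=> [mf [M hM]]; split; first exact: measurableT_comp.
by exists M => w; rewrite normr_id.
Qed.

Lemma bounded_rv_sum (I : Type) (r : seq I) (F : I -> T -> R) :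
  (forall i, bounded_rv (F i)) -> bounded_rv (fun w => \sum_(i <- r) F i w).
Proof.
move=> hF; elim: r => [|i r IHr].
  by under eq_fun do rewrite big_nil; exact: bounded_rv_cst.
by under eq_fun do rewrite big_cons; exact: bounded_rvD.
Qed.

Lemma bounded_rv_indic (A : set T) : measurable A -> bounded_rv (\1_A : T -> R).
Proof.
move=> mA; split; first exact: measurable_indic.
by exists 1 => w; rewrite indicE; case: (_ \in _); rewrite ?normr1 ?normr0.
Qed.

Lemma expect_cst (r : R) : expect (fun=> r) = r.
Proof.
by rewrite /expect Rintegral_cst//= probability_setT mulr1.
Qed.

Lemma expectD f g : bounded_rv f -> bounded_rv g ->
  expect (fun w => f w + g w) = expect f + expect g.
Proof. by move=> bf bg; apply: RintegralD => //; exact: bounded_rv_integrable. Qed.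

Lemma expectB f g : bounded_rv f -> bounded_rv g ->
  expect (fun w => f w - g w) = expect f - expect g.
Proof. by move=> bf bg; apply: RintegralB => //; exact: bounded_rv_integrable. Qed.

Lemma expectZ (r : R) f : bounded_rv f ->
  expect (fun w => r * f w) = r * expect f.
Proof. by move=> bf; apply: RintegralZl => //; exact: bounded_rv_integrable. Qed.

Lemma expect_sum (I : Type) (r : seq I) (F : I -> T -> R) :
  (forall i, bounded_rv (F i)) ->
  expect (fun w => \sum_(i <- r) F i w) = \sum_(i <- r) expect (F i).
Proof.
move=> hF; elim: r => [|i r IHr].
  by under [in LHS]eq_fun do rewrite big_nil; rewrite big_nil expect_cst.
under [in LHS]eq_fun do rewrite big_cons; rewrite big_cons -IHr.
by apply: expectD => //; exact: bounded_rv_sum.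
Qed.

Lemma le_expect f g : bounded_rv f -> bounded_rv g ->
  (forall w, f w <= g w) -> expect f <= expect g.
Proof.
by move=> bf bg fg; apply: le_Rintegral => //; exact: bounded_rv_integrable.
Qed.

Lemma le_norm_expect f g : bounded_rv f -> bounded_rv g ->
  (forall w, `|f w| <= g w) -> `|expect f| <= expect g.
Proof.
move=> bf bg fg.
apply: le_trans (le_expect (bounded_rv_norm bf) bg fg).
by apply: le_normr_Rintegral => //; exact: bounded_rv_integrable.
Qed.

Lemma le_norm_expect_cst f (M : R) : bounded_rv f ->
  (forall w, `|f w| <= M) -> `|expect f| <= M.
Proof.
move=> bf hM; rewrite -[leRHS]expect_cst.
by apply: le_norm_expect => //; exact: bounded_rv_cst.
Qed.

Lemma expect_comb3 (U V W : T -> R) (r q : R) :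
  bounded_rv U -> bounded_rv V -> bounded_rv W ->
  expect (fun w => - U w - r * V w + q * W w) =
  - expect U - r * expect V + q * expect W.
Proof.
move=> bU bV bW; have bUV := bounded_rvB (bounded_rvZ (-1) bU) (bounded_rvZ r bV).
transitivity (expect (fun w => (-1 * U w - r * V w) + q * W w)).
  by congr expect; apply/funext => w; rewrite mulN1r.
rewrite expectD//; last exact: bounded_rvZ.
rewrite expectB; try exact: bounded_rvZ.
by rewrite !expectZ// mulN1r.
Qed.

Lemma expect_indic (A : set T) : measurable A -> expect (\1_A) = fine (P A).
Proof. by move=> mA; rewrite /expect /Rintegral integral_indic// setIT. Qed.

Lemma expect_cvg (F : nat -> T -> R) f (M : R) :
  (forall m, measurable_fun setT (F m)) -> (forall m w, `|F m w| <= M) ->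
  (forall w, F ^~ w @ \oo --> f w) ->
  expect (F m) @[m --> \oo] --> expect f.
Proof.
move=> mF bF cF.
have mf : measurable_fun setT f by apply: measurable_fun_cvg => // w _; exact: cF.
have bM := bounded_rv_integrable (bounded_rv_cst M).
have cv : (\int[P]_w (F m w)%:E)%E @[m --> \oo] --> (\int[P]_w (f w)%:E)%E.
  apply: (@dominated_cvg _ _ _ P setT measurableT
    (fun m w => (F m w)%:E) (fun w => (f w)%:E) (fun=> M%:E)) => //.
  - by move=> m; apply/measurable_EFinP.
  - by move=> w _; apply: cvg_EFin; [apply: nearW|exact: cF].
  - by move=> m w _ /=; rewrite lee_fin.
rewrite /expect /Rintegral.
apply: fine_cvg; rewrite fineK//.
apply: integrable_fin_num => //; apply: bounded_rv_integrable; split => //.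
exists M => w; apply: (cvgr_to_le (cvg_norm (cF w))).
by apply: nearW => m; exact: bF.
Qed.

End Expectation.

(** * Independence on a finite grid of times *)

Section Independence.
Context (R : realType) (d : measure_display) (T : measurableType d).
Variable P : probability T R.

Lemma mutually_independent_full (I : finType) (F : I -> set (set T))
    (A : I -> set T) : mutually_independent P F -> (forall i, F i (A i)) ->
  P [set w | forall i, A i w] = (\prod_i P (A i))%E.
Proof.
move=> hF hA; have := hF [set: I]%SET A (fun i _ => hA i).
rewrite [X in P X](_ : _ = [set w | forall i, A i w]); last first.
  apply/seteqP; split=> w /= h i; last by move=> _; exact: h.
  by apply: h; rewrite /= inE.
by move=> ->; apply: eq_bigl => i; rewrite inE.
Qed.

Lemma sigma_of_preimage d' (T' : measurableType d') (Y : T -> T') (A : set T') :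
  measurable A -> sigma_of Y (Y @^-1` A).
Proof. by move=> mA; exists A => //; rewrite setTI. Qed.

Definition incr (M : R -> T -> nat) (s t : R) (w : T) : nat :=
  (M t w - M s w)%N.

Section OnePoisson.
Variables (lam : R) (M : R -> T -> nat).
Hypothesis hM : poisson_process P lam M.

Lemma measurable_incr s t : 0 <= s -> 0 <= t -> measurable_fun setT (incr M s t).
Proof.
by move=> s0 t0; apply: measurable_fun_subn; exact: (poisson_measurable hM).
Qed.

Lemma incr_joint m (t : nat -> R) (C : 'I_m -> set nat) :
  0 <= t 0%N -> (forall i, t i <= t i.+1) ->
  P [set w | forall i : 'I_m, C i (incr M (t i) (t i.+1) w)] =
  (\prod_(i < m) P (incr M (t i) (t i.+1) @^-1` C i))%E.
Proof.
move=> t0 tm.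
have H := poisson_indep_incr hM (m := m) t0 tm.
have := @mutually_independent_full _ _ (fun i : 'I_m => incr M (t i) (t i.+1) @^-1` C i) H.
apply => i.
exact: sigma_of_preimage.
Qed.

(** An increment is the difference of two functions that are measurable for the
    sigma-algebra of the process by construction. *)
Lemma sigma_of_process_incr s t (C : set nat) : 0 <= s -> 0 <= t ->
  sigma_of_process M (incr M s t @^-1` C).
Proof.
move=> s0 t0; rewrite /sigma_of_process.
set G := \bigcup_(t in _) _.
pose T' := g_sigma_algebraType G.
have mM (r : R) : 0 <= r -> measurable_fun [set: T'] (M r : T' -> nat).
  move=> r0 _ Y _; apply: sub_sigma_algebra; exists r => //.
  by rewrite setTI; exact: sigma_of_preimage.
have := @measurable_fun_subn _ T' setT (M t) (M s) (mM t t0) (mM s s0).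
move=> /(_ measurableT C) H; rewrite -[_ @^-1` _]setTI.
exact: H.
Qed.

Lemma sigma_of_process_forall m (F : 'I_m -> set T) :
  (forall i, sigma_of_process M (F i)) ->
  sigma_of_process M [set w | forall i, F i w].
Proof.
rewrite /sigma_of_process; set G := \bigcup_(t in _) _ => hF.
have -> : [set w | forall i, F i w] = \bigcap_(i in [set: 'I_m]) F i.
  by apply/seteqP; split=> w /= h i; [move=> _; exact: h|exact: h].
by apply: (@fin_bigcap_measurable _ (g_sigma_algebraType G)) => // i _; exact: hF.
Qed.

End OnePoisson.

Variables (n : nat) (lam : 'I_n -> R).
Variables (D0 : 'I_n -> T -> R) (N : 'I_n -> R -> T -> nat).
Hypothesis hD0 : forall k, initial_direction P (D0 k).
Hypothesis hN : forall k, poisson_process P (lam k) (N k).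
Hypothesis hindep : independent_telegraph_data P D0 N.

Local Notation D k := (direction (D0 k) (N k)).

Definition sign_value (b : bool) : R := if b then 1 else -1.

(** The points [0, mesh, ..., s] of a grid of [0, s] followed by [s + delta];
    all later indices give [s + delta] so that the sequence is monotone, as the
    independence of increments requires. *)
Definition grid_time (s delta : R) m (i : nat) : R :=
  if (i <= m.+1)%N then i%:R * (s / m.+1%:R) else s + delta.

Section Grid.
Variables (s delta : R) (m : nat).
Hypotheses (s0 : 0 <= s) (delta0 : 0 <= delta).

Local Notation tt := (grid_time s delta m).
Local Notation sg := sign_value.

Let mesh_ge0 : 0 <= s / m.+1%:R. Proof. by rewrite divr_ge0. Qed.

Let tt_end : tt m.+1 = s.
Proof. by rewrite /grid_time leqnn mulrC divfK. Qed.

Let tt_next : tt m.+2 = s + delta.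
Proof. by rewrite /grid_time ltnn. Qed.

Let tt_mono i : tt i <= tt i.+1.
Proof.
rewrite /grid_time; case: (ltngtP i m.+1) => [im|im|->].
- by rewrite ler_wpM2r// ler_nat.
- by [].
- by rewrite mulrC divfK ?lerDl.
Qed.

Let tt_ge0 i : 0 <= tt i.
Proof. by rewrite /grid_time; case: ifP => _; rewrite ?mulr_ge0// addr_ge0. Qed.

Let S := {ffun 'I_n * 'I_m.+2 -> bool}.
(** Keeping signs only, and not the values of the Poisson processes, makes this
    random variable take finitely many values. *)
Definition signs (w : T) : S := [ffun p : 'I_n * 'I_m.+2 => D p.1 (tt p.2) w == 1].

Let sg_inj : injective sg.
Proof.
have n11 : (-1 : R) == 1 = false by apply: lt_eqF; lra.
by case=> -[]//=; rewrite /sign_value => /eqP; rewrite ?n11 1?eq_sym ?n11.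
Qed.

Let sgM b j : sg b * (-1) ^+ j = sg (b (+) odd j).
Proof.
by rewrite -signr_odd /sign_value; case: b (odd j) => -[];
  rewrite /= ?expr0 ?expr1 ?mulr1 ?mulrN1 ?opprK.
Qed.

Lemma direction_sg w k t : D k t w = sg (D k t w == 1).
Proof.
have n11 : (-1 : R) == 1 = false by apply: lt_eqF; lra.
rewrite /sign_value /direction -signr_odd.
by case: (direction_values (hD0 k) w) => ->; case: odd;
  rewrite ?expr0 ?expr1 ?mulr1 ?mulrNN ?mulrN1 ?opprK ?mul1r ?eqxx ?n11.
Qed.

Lemma signs_direction w k (i : 'I_m.+2) : D k (tt i) w = sg (signs w (k, i)).
Proof. by rewrite ffunE/= -direction_sg. Qed.

Lemma signs_step w k (i : 'I_m.+1) :
  signs w (k, lift ord0 i) = signs w (k, widen_ord (leqnSn _) i)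
    (+) odd (incr (N k) (tt i) (tt i.+1) w).
Proof.
apply: sg_inj; rewrite -sgM -!signs_direction /direction -mulrA -exprD.
by rewrite /incr subnKC// (poisson_mono (hN k)).
Qed.

Lemma signs_ord0 w k : D0 k w = sg (signs w (k, ord0)).
Proof.
rewrite -signs_direction /direction/= /grid_time/= mul0r (poisson_start (hN k)).
by rewrite expr0 mulr1.
Qed.

Definition step_parity (v : S) k (i : nat) : set nat :=
  [set j | odd j = (v (k, inord i) != v (k, inord i.+1))].

Let stepE w k i : (i < m.+1)%N ->
  signs w (k, inord i.+1) = signs w (k, inord i)
    (+) odd (incr (N k) (tt i) (tt i.+1) w).
Proof.
move=> im; have := signs_step w k (Ordinal im).
have -> : lift ord0 (Ordinal im) = inord i.+1.
  by apply: val_inj; rewrite /= inordK.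
have -> // : widen_ord (leqnSn m.+1) (Ordinal im) = inord i.
by apply: val_inj; rewrite /= inordK// ltnW.
Qed.

(** Consecutive signs differ exactly if the increment in between is odd, so a
    whole sign pattern is prescribed by the initial directions and by the
    parities of disjoint increments, which are mutually independent. *)
Lemma signs_fibre v : [set w | signs w = v] =
  [set w | forall k, D0 k w = sg (v (k, ord0))] `&`
  [set w | forall k i, (i < m.+1)%N ->
     step_parity v k i (incr (N k) (tt i) (tt i.+1) w)].
Proof.
apply/seteqP; split=> w /=.
  move=> <-; split=> k; first exact: signs_ord0.
  move=> i im; rewrite /step_parity/= stepE//.
  by case: (signs w _); case: odd.
move=> [h0' hs]; apply/ffunP => -[k i].
suff H j : (j < m.+2)%N -> signs w (k, inord j) = v (k, inord j).
  by have := H i (ltn_ord i); rewrite inord_val.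
elim: j => [_|j IHj jm].
  have -> : inord 0 = ord0 :> 'I_m.+2 by apply: val_inj; rewrite /= inordK.
  by apply: sg_inj; rewrite -signs_ord0 h0'.
rewrite stepE// (IHj (ltnW jm)); have /= -> := hs k j jm.
by case: (v _); case: (v _).
Qed.

Definition level_set (v : S) (C : 'I_n -> set nat) : set T :=
  [set w | signs w = v] `&`
  [set w | forall k, C k (incr (N k) s (s + delta) w)].

(** Independence of the [2 n] sources splits the probability over the
    processes, and independent increments split each factor over the time
    steps; the last step, from [s] to [s + delta], is the one not constrained
    by the signs. *)
Lemma prob_level_set v C : P (level_set v C) =
  (\prod_(k < n) (P (D0 k @^-1` [set sg (v (k, ord0))]) *
    \prod_(i < m.+1) P (incr (N k) (tt i) (tt i.+1) @^-1` step_parity v k i)) *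
   \prod_(k < n) P (incr (N k) s (s + delta) @^-1` C k))%E.
Proof.
(* The constraints on all increments: parities up to time [s], then [C k]. *)
pose CC k (i : 'I_m.+2) := if (i < m.+1)%N then step_parity v k i else C k.
pose A (j : 'I_n + 'I_n) : set T := match j with
  | inl k => D0 k @^-1` [set sg (v (k, ord0))]
  | inr k => [set w | forall i : 'I_m.+2, CC k i (incr (N k) (tt i) (tt i.+1) w)]
  end.
have -> : level_set v C = [set w | forall j, A j w].
  rewrite /level_set signs_fibre; apply/seteqP; split=> w /=.
    move=> [[h1 h2] h3] [k|k] /=; first exact: h1.
    move=> i; rewrite /CC; case: ltnP => im; first exact: h2.
    have -> : (i : nat) = m.+1 by apply/eqP; rewrite eqn_leq im -ltnS ltn_ord.
    by rewrite tt_end tt_next.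
  move=> hw; split; first split.
  - by move=> k; exact: (hw (inl k)).
  - move=> k i im; have := hw (inr k) (inord i).
    by rewrite /CC inordK ?im// ltnW.
  - move=> k; have := hw (inr k) ord_max.
    by rewrite /CC ltnn/= tt_end tt_next.
rewrite (@mutually_independent_full _ _ A hindep); last first.
  case=> k /=; first exact: sigma_of_preimage.
  apply: sigma_of_process_forall => i.
  exact: sigma_of_process_incr.
rewrite big_sumType/= big_split/= -muleA; congr (_ * _)%E.
rewrite -big_split/=; apply: eq_bigr => k _.
rewrite (incr_joint (hN k) _ (tt_ge0 0) tt_mono) big_ord_recr/=.
rewrite {2}/CC ltnn tt_end tt_next; congr (_ * _)%E.
by apply: eq_bigr => i _; rewrite /CC/= ltn_ord.
Qed.

(** [prob_level_set] with the trivial constraint on the last increments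
    identifies the other factors as the probability of the sign pattern. *)
Lemma level_set_indep v C : P (level_set v C) =
  (P [set w | signs w = v] *
   \prod_(k < n) P (incr (N k) s (s + delta) @^-1` C k))%E.
Proof.
rewrite prob_level_set; congr (_ * _)%E.
have := prob_level_set v (fun=> setT).
rewrite [X in (_ * X)%E]big1 ?mule1 => [|k _]; last first.
  by rewrite preimage_setT probability_setT.
move=> <-; congr (P _); rewrite /level_set -[RHS]setIT; congr (_ `&` _).
by apply/seteqP; split.
Qed.

Lemma measurable_signs v : measurable [set w | signs w = v].
Proof.
rewrite signs_fibre; apply: measurableI.
  have -> : [set w | forall k, D0 k w = sg (v (k, ord0))] =
    \bigcap_(k in [set: 'I_n]) (D0 k @^-1` [set sg (v (k, ord0))]).
    by apply/seteqP; split=> w /= hw k; [move=> _; exact: hw|exact: hw].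
  apply: fin_bigcap_measurable => // k _; rewrite -[_ @^-1` _]setTI.
  by apply: (direction_measurable (hD0 k)).
have -> : [set w | forall k i, (i < m.+1)%N ->
     step_parity v k i (incr (N k) (tt i) (tt i.+1) w)] =
    \bigcap_(k in [set: 'I_n]) \bigcap_(i in [set: 'I_m.+1])
      (incr (N k) (tt i) (tt i.+1) @^-1` step_parity v k i).
  apply/seteqP; split=> w /= hw k; first by move=> _ i _; exact: hw.
  by move=> i im; exact: (hw k I (Ordinal im) I).
apply: fin_bigcap_measurable => // k _; apply: fin_bigcap_measurable => // i _.
rewrite -[_ @^-1` _]setTI.
by apply: (measurable_incr (hN k) (tt_ge0 _) (tt_ge0 _)).
Qed.

Definition incr_event (C : 'I_n -> set nat) : set T :=
  [set w | forall k, C k (incr (N k) s (s + delta) w)].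

Lemma measurable_incr_event C : measurable (incr_event C).
Proof.
have -> : incr_event C =
    \bigcap_(k in [set: 'I_n]) (incr (N k) s (s + delta) @^-1` C k).
  by apply/seteqP; split=> w /= hw k; [move=> _; exact: hw|exact: hw].
apply: fin_bigcap_measurable => // k _; rewrite -[_ @^-1` _]setTI.
by apply: (measurable_incr (hN k)) => //; rewrite addr_ge0.
Qed.

(** A function of [signs] is a finite combination of indicators of its
    fibres. *)
Lemma expect_signs_indep (f : S -> R) C :
  expect P (fun w => \1_(incr_event C) w * f (signs w)) =
  (\prod_(k < n) fine (P (incr (N k) s (s + delta) @^-1` C k))) *
  expect P (fun w => f (signs w)).
Proof.
have fE w : f (signs w) = \sum_(v : S) f v * \1_[set w | signs w = v] w.
  rewrite (bigD1 (signs w))//= indicE mem_set// mulr1 big1 ?addr0// => v vn.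
  by rewrite indicE memNset ?mulr0//= => e; rewrite e eqxx in vn.
have bv v : bounded_rv (\1_[set w | signs w = v] : T -> R).
  exact/bounded_rv_indic/measurable_signs.
(* On each fibre, both sides reduce to [level_set_indep]. *)
rewrite [in RHS](funext fE).
rewrite expect_sum; last by move=> v; exact: bounded_rvZ.
rewrite mulr_sumr.
have -> : (fun w => \1_(incr_event C) w * f (signs w)) =
    (fun w => \sum_(v : S) f v * \1_(level_set v C) w).
  apply/funext => w; rewrite fE mulr_sumr; apply: eq_bigr => v _.
  by rewrite mulrCA; congr (_ * _); rewrite /level_set indicI/= mulrC.

have mL v : measurable (level_set v C).
  exact: measurableI (measurable_signs v) (measurable_incr_event C).
rewrite expect_sum => [|v]; last exact/bounded_rvZ/bounded_rv_indic.
apply: eq_bigr => v _; rewrite !expectZ//; last exact/bounded_rv_indic.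
rewrite !expect_indic//; last exact: measurable_signs.
rewrite mulrCA; congr (_ * _).
rewrite level_set_indep.
have fin k : P (incr (N k) s (s + delta) @^-1` C k) =
    (fine (P (incr (N k) s (s + delta) @^-1` C k)))%:E.
  rewrite fineK// fin_num_measure// -[_ @^-1` _]setTI.
  by apply: (measurable_incr (hN k)) => //; rewrite addr_ge0.
under eq_bigr do rewrite fin.
rewrite prodEFin -[P _]fineK; last exact/fin_num_measure/measurable_signs.
by rewrite -EFinM/= mulrC.
Qed.

End Grid.
End Independence.

(** * Transition probabilities of the sign vector *)

Section SignVectors.
Variable n : nat.

(** The quotients of an index by the powers of 2 are recovered from the binary
    digits by descending induction on the exponent. *)
Lemma sigma_inj (k l : 'I_(2 ^ n)) : sigma k =1 sigma l -> k = l.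
Proof.
move=> kl; apply/val_inj => /=.
have bit i : (i < n)%N -> odd (k %/ 2 ^ i) = odd (l %/ 2 ^ i).
  move=> hi; have := kl (rev_ord (Ordinal hi)); rewrite /sigma/=.
  have -> : (n - (n - i.+1).+1 = i)%N by lia.
  by case: odd; case: odd.
have half (a i : nat) : (a %/ 2 ^ i)./2 = (a %/ 2 ^ i.+1)%N.
  by rewrite -divn2 -divnMA expnSr.
(* Starting from the exponent [n], for which both quotients are 0. *)
suff H i : (i <= n)%N -> (k %/ 2 ^ (n - i) = l %/ 2 ^ (n - i))%N.
  by have := H n (leqnn n); rewrite subnn expn0 !divn1.
elim: i => [|i IHi] hi; first by rewrite subn0 !divn_small.
have e : (n - i = (n - i.+1).+1)%N by lia.
rewrite -(odd_double_half (k %/ _)) -(odd_double_half (l %/ _)) !half -e.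
rewrite IHi ?(ltnW hi)// bit//; lia.
Qed.

Lemma sigma_sign (k : 'I_(2 ^ n)) j : sigma k j = if sigma k j == 1 then 1 else -1.
Proof. by rewrite /sigma; case: odd. Qed.

(** An injection between finite sets of the same cardinality is onto. *)
Lemma sigma_onto (e : 'I_n -> bool) :
  exists k : 'I_(2 ^ n), forall j, sigma k j = if e j then 1 else -1.
Proof.
pose f (k : 'I_(2 ^ n)) := [ffun j => sigma k j == 1].
have finj : injective f.
  move=> k l /ffunP kl; apply: sigma_inj => j.
  by have := kl j; rewrite !ffunE => h; rewrite sigma_sign h -sigma_sign.
have : [ffun j => e j] \in codom f.
  apply: inj_card_onto => //.
  by rewrite card_ffun card_bool !card_ord.
move=> /codomP[k /ffunP ek]; exists k => j; rewrite sigma_sign.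
by have := ek j; rewrite !ffunE => <-.
Qed.

End SignVectors.

Section TransitionRates.
Variable R : realType.

(** The first two Bonferroni inequalities, in a weakened form that is stable
    under adding a factor. *)
Lemma prod_onem_bounds (I : Type) (r : seq I) (p : pred I) (q : I -> R) :
  (forall i, 0 <= q i <= 1) ->
  [/\ 0 <= \sum_(i <- r | p i) q i,
      0 <= \prod_(i <- r | p i) (1 - q i) <= 1,
      1 - \sum_(i <- r | p i) q i <= \prod_(i <- r | p i) (1 - q i) &
      \prod_(i <- r | p i) (1 - q i) <=
        1 - \sum_(i <- r | p i) q i + (\sum_(i <- r | p i) q i) ^+ 2].
Proof.
move=> hq; elim/big_rec2: _ => [|i A B _ [A0 /andP[B0 B1] h1 h2]].
  by rewrite !lexx ler01; split=> //; nra.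
have /andP[q0 q1] := hq i.
by split; [lra|apply/andP; split; nra|nra|nra].
Qed.

(** The probability that exactly the coordinates in [D] switch, when coordinate
    [i] does so independently with probability close to [lam i * delta]. No
    switch, one switch and several switches are of order 0, 1 and at least 2 in
    [delta]. *)
Lemma prod_switch_first_order (I : finType) (D : {set I}) (q lam : I -> R) (delta : R) :
  0 <= delta -> (forall i, 0 <= lam i) ->
  (forall i, 0 <= q i <= 1) -> (forall i, q i <= lam i * delta) ->
  (forall i, `|q i - lam i * delta| <= (lam i * delta) ^+ 2) ->
  `|\prod_i (if i \in D then q i else 1 - q i) -
    ((D == finset.set0)%:R + delta * (if #|D| == 1%N then \sum_(i in D) lam i
        else if D == finset.set0 then - \sum_i lam i else 0))|
    <= 2 * (\sum_i lam i) ^+ 2 * delta ^+ 2.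
Proof.
move=> d0 l0 hq hql hqa.
set S := \sum_i lam i.
have lS i : lam i <= S.
  by rewrite /S (bigD1 i)//= lerDl sumr_ge0.
have S0 : 0 <= S by apply: sumr_ge0.
have qS : \sum_i q i <= S * delta.
  by rewrite /S mulr_suml; apply: ler_sum => i _; exact: hql.
have [->|Dn0] := eqVneq D finset.set0.
  rewrite cards0/= (eq_bigr (fun i => 1 - q i)) => [|i _]; last by rewrite finset.in_set0.
  have [s0 _ b1 b2] := prod_onem_bounds (index_enum I) xpredT hq.
  (* A sum of squares is at most the square of the sum. *)
  have qd : `|\sum_i q i - S * delta| <= S ^+ 2 * delta ^+ 2.
    rewrite /S mulr_suml -sumrB; apply: le_trans (ler_norm_sum _ _ _) _.
    apply: (@le_trans _ _ (\sum_i (lam i * delta) ^+ 2)).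
      by apply: ler_sum => i _.
    rewrite -exprMn [X in _ <= X ^+ 2]mulr_suml [leRHS]expr2 mulr_suml.
    apply: ler_sum => i _; rewrite expr2 ler_wpM2l ?mulr_ge0//.
    rewrite (bigD1 i)//= lerDl sumr_ge0// => j _.
    by rewrite mulr_ge0.
  move: s0 b1 b2 qd qS; move: (\prod_i _) (\sum_i q i) => Pi Q Q0 b1 b2.
  rewrite ler_norml => /andP[b3 b4] qS.
  have Q2 : Q ^+ 2 <= S ^+ 2 * delta ^+ 2.
    by rewrite -exprMn ler_sqr ?nnegrE ?mulr_ge0.
  by rewrite ler_norml; apply/andP; split; lra.
have pr_ge0 (A : {set I}) : 0 <= \prod_(i in A) (if i \in D then q i else 1 - q i) <= 1.
  apply: (big_ind (fun x => 0 <= x <= 1)); first by rewrite ler01 lexx.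
    by move=> x y /andP[x0 x1] /andP[y0 y1]; apply/andP; split; nra.
  by move=> i _; have /andP[q0 q1] := hq i; case: ifP => _; apply/andP; split; lra.
have S2 : 0 <= S ^+ 2 * delta ^+ 2 by rewrite mulr_ge0 ?sqr_ge0.
case: ifP => [/cards1P[k ->]|D1].
  rewrite big_set1 (bigD1 k)//= finset.in_set1 eqxx add0r.
  rewrite (eq_bigr (fun i => 1 - q i)) => [|i /negPf]; last by rewrite finset.in_set1 => ->.
  have [s0 /andP[b0 b0'] b1 b2] := prod_onem_bounds (index_enum I) (fun i => i != k) hq.
  have sk : \sum_(i | i != k) q i <= S * delta.
    apply: le_trans qS; rewrite [leRHS](bigD1 k)//= lerDr.
    by have /andP[] := hq k.
  move: s0 b0 b0' b1 b2 sk; move: (\prod_(i | _) _) (\sum_(i | _) q i).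
  move=> Pi Q Q0 P0 P1 b1 b2 sk.
  have /andP[q0 q1] := hq k; have := hqa k; have qk := hql k.
  have lk : lam k * delta <= S * delta by rewrite ler_wpM2r.
  have lk0 : 0 <= lam k * delta by rewrite mulr_ge0.
  have lk2 : (lam k * delta) ^+ 2 <= S ^+ 2 * delta ^+ 2.
    by rewrite -exprMn ler_sqr ?nnegrE ?mulr_ge0.
  have qQ : q k * Q <= S ^+ 2 * delta ^+ 2.
    by rewrite -exprMn expr2; apply: ler_pM => //; exact: le_trans lk.
  rewrite !ler_norml => /andP[b3 b4]; apply/andP; split; nra.
have [k kD] : exists k, k \in D by apply/finset.set0Pn.
have [l lD lk] : exists2 l, l \in D & l != k.
  have : (D :\ k)%SET != finset.set0.
    apply: contraFneq D1 => e; apply/cards1P; exists k.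
    by rewrite -(finset.setD1K kD) e finset.setU0.
  by case/finset.set0Pn => l /finset.setD1P[lk lD]; exists l.
rewrite mulr0 addr0 subr0 (bigD1 k)//= kD (bigD1 l)//= lD.
have := pr_ge0 [set i | (i != k) && (i != l)]%SET.
under eq_bigl do rewrite inE.
move: (\prod_(i | _) _) => Pi /andP[P0 P1].
have /andP[qk0 _] := hq k; have /andP[ql0 _] := hq l.
(* Two distinct factors of size [O(delta)] suffice; the others are at most
   1. *)
have qkl : q k * q l <= S ^+ 2 * delta ^+ 2.
  rewrite -exprMn expr2; apply: ler_pM => //.
    by apply: le_trans (hql k) _; rewrite ler_wpM2r.
  by apply: le_trans (hql l) _; rewrite ler_wpM2r.
have qq : 0 <= q k * q l by rewrite mulr_ge0.
rewrite mulrA ger0_norm ?mulr_ge0//; nra.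
Qed.

End TransitionRates.

Section PoissonIncrement.
Context (R : realType) (d : measure_display) (T : measurableType d).
Variables (P : probability T R) (lam : R) (M : R -> T -> nat).
Hypotheses (hlam : 0 < lam) (hM : poisson_process P lam M).
Variables (s delta : R).
Hypotheses (s0 : 0 <= s) (delta0 : 0 < delta).

Let prob (C : set nat) := fine (P (incr M s (s + delta) @^-1` C)).

Let measurable_incr_set C : measurable (incr M s (s + delta) @^-1` C).
Proof.
rewrite -[_ @^-1` _]setTI.
by apply: (measurable_incr hM) => //; rewrite addr_ge0// ltW.
Qed.

Lemma prob_incr_bounds C : 0 <= prob C <= 1.
Proof.
rewrite /prob; apply/andP; split; first exact: fine_ge0.
rewrite -lee_fin fineK ?probability_le1//.
by rewrite fin_num_measure.
Qed.

Lemma le_prob_incr C C' : C `<=` C' -> prob C <= prob C'.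
Proof.
move=> CC; rewrite /prob fine_le ?fin_num_measure//.
by apply: le_measure; rewrite ?inE// => w /CC.
Qed.

Lemma prob_incrC C : prob (~` C) = 1 - prob C.
Proof.
rewrite /prob -preimage_setC probability_setC// fineB ?fin_num_measure//.
Qed.

Lemma prob_incr_law k : prob [set k] = (lam * delta) ^+ k / k`!%:R * expR (- (lam * delta)).
Proof.
have st : s < s + delta by rewrite ltrDl.
have := poisson_law hM k s0 st; rewrite /prob => ->.
by rewrite /= /poisson_pmf (addrC s) addrK mulr_gt0.
Qed.

Lemma prob_jump : prob [set k | (0 < k)%N] <= lam * delta.
Proof.
have -> : [set k | (0 < k)%N] = ~` [set 0%N].
  apply/seteqP; split=> -[|k] //= h; exfalso; exact: h.
rewrite prob_incrC prob_incr_law expr0 fact0 divr1 mul1r.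
have := expR_ge1Dx (- (lam * delta)); lra.
Qed.

Lemma prob_odd_le : prob [set k | odd k] <= lam * delta.
Proof. by apply: le_trans prob_jump; apply: le_prob_incr => -[]. Qed.

(** The probability of an odd increment lies between those of exactly one jump
    and of at least one jump, which agree to first order. *)
Lemma prob_odd_approx :
  `|prob [set k | odd k] - lam * delta| <= (lam * delta) ^+ 2.
Proof.
have h1 := prob_odd_le.
have h2 : prob [set 1%N] <= prob [set k | odd k].
  by apply: le_prob_incr => k ->.
rewrite prob_incr_law expr1 factS fact0 divr1 in h2.
have := expR_ge1Dx (- (lam * delta)).
have : 0 < lam * delta by rewrite mulr_gt0.
move: (expR _) h2 h1 => e; move: (lam * delta) (prob _) => x p h2 h1 x0 ex.
by rewrite ler_norml; apply/andP; split; nra.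
Qed.

End PoissonIncrement.

(** * Uniform first-order expansions *)

Section FirstOrder.
Variable R : realType.
Implicit Types g h : R -> R.

(** A derivative with a quadratic remainder that is uniform in [s]; only
    increments to the right are constrained, which is what the Markov property
    provides. *)
Definition first_order g h := exists K : R, forall s delta, 0 <= s -> 0 < delta ->
  `|g (s + delta) - g s - delta * h s| <= K * delta ^+ 2.

Lemma first_order_sum (I : Type) (r : seq I) (g h : I -> R -> R) :
  (forall i, first_order (g i) (h i)) ->
  first_order (fun t => \sum_(i <- r) g i t) (fun t => \sum_(i <- r) h i t).
Proof.
move=> gh; elim: r => [|i r [K hK]].
  by exists 0 => s delta _ _; rewrite !big_nil mulr0 !subr0 normr0 mul0r.
have [K' hK'] := gh i; exists (K' + K) => s delta s0 d0; rewrite !big_cons.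
rewrite mulrDl; apply: le_trans (lerD (hK' _ _ s0 d0) (hK _ _ s0 d0)).
apply: le_trans (ler_normD _ _); rewrite le_eqVlt; apply/orP; left; apply/eqP.
by congr `|_|; ring.
Qed.

Lemma first_orderN g h : first_order g h ->
  first_order (fun t => - g t) (fun t => - h t).
Proof.
case=> K hK; exists K => s delta s0 d0; apply: le_trans (hK _ _ s0 d0).
by rewrite -normrN le_eqVlt; apply/orP; left; apply/eqP; congr `|_|; ring.
Qed.

(** The expansion with step 1 bounds [h] in terms of a bound on [g], and the
    expansion with a short step then bounds the increments of [g]. *)
Lemma first_order_lip g h (M : R) : first_order g h ->
  (forall t, 0 <= t -> `|g t| <= M) ->
  exists C : R, forall s delta, 0 <= s -> 0 < delta <= 1 ->
    `|g (s + delta) - g s| <= C * delta.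
Proof.
move=> [K hK] hM; exists (2 * M + 2 * K) => s delta s0 /andP[d0 d1].
have h1 := hK s 1 s0 ltr01; have h2 := hK s _ s0 d0.
have g1 := hM (s + 1) (addr_ge0 s0 ler01); have g2 := hM s s0.
rewrite expr1n mulr1 mul1r in h1.
have K0 : 0 <= K by apply: le_trans h1.
have hb : `|h s| <= 2 * M + K.
  move: h1 g1 g2; rewrite !ler_norml => /andP[? ?] /andP[? ?] /andP[? ?].
  by apply/andP; split; lra.
have -> : g (s + delta) - g s = (g (s + delta) - g s - delta * h s) + delta * h s.
  by rewrite subrK.
apply: le_trans (ler_normD _ _) _; rewrite normrM (gtr0_norm d0).
have : delta * `|h s| <= delta * (2 * M + K) by rewrite ler_wpM2l// ltW.
have : K * delta ^+ 2 <= K * delta.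
  by rewrite ler_wpM2l// expr2 ler_piMr// ltW.
by move: h2; lra.
Qed.

(** The difference quotient to the left of [s] is the one to the right of [s -
    delta], and the Lipschitz bound compares [h (s - delta)] with [h s]. *)
Lemma first_order_is_derive g h (C : R) : first_order g h ->
  (forall s delta, 0 <= s -> 0 < delta <= 1 ->
     `|h (s + delta) - h s| <= C * delta) ->
  forall s : R, 0 < s -> is_derive s 1 g (h s).
Proof.
move=> [K hK] hC s s0.
have K0 : 0 <= K.
  by have := hK 0 1 (lexx _) ltr01; rewrite expr1n mulr1; apply: le_trans.
have C0 : 0 <= C.
  by have := hC 0 1 (lexx _); rewrite lexx ltr01 mulr1 => /(_ isT); apply: le_trans.
have lim : (fun e => e^-1 *: ((g \o shift s) (e *: 1) - g s)) @ 0^' --> h s.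
  apply/cvgrPdist_le => e e0.
  (* Steps shorter than [s] keep [s - delta] in the half-line, steps shorter
     than 1 allow the Lipschitz bound; the 1 in the denominator excludes a
     division by 0. *)
  pose r := Num.min 1 (Num.min s (e / (K + C + 1))).
  have KC : 0 < K + C + 1 by lra.
  have r0 : 0 < r by rewrite !lt_min ltr01 s0 divr_gt0.
  apply/nbhs_ballP; exists r => //= y; rewrite /ball/= sub0r normrN => yr yn0.
  move: yr; rewrite !lt_min => /and3P[y1 ys ye].
  have ye' : (K + C) * `|y| <= e.
    rewrite ltr_pdivlMr// in ye.
    have := normr_ge0 y; nra.
  apply: le_trans ye'; rewrite /shift/= /GRing.scale/= mulr1.
  have n0 : 0 < `|y| by rewrite normr_gt0.
  rewrite -(ler_pM2l n0) -normrM mulrBr mulrA mulfV// mul1r.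
  have [y0|y0] := ltP 0 y.
    rewrite distrC (addrC y) (gtr0_norm y0).
    apply: le_trans (hK s y (ltW s0) y0) _.
    have := sqr_ge0 y; nra.
  have {}y0 : y < 0 by rewrite lt_neqAle yn0.
  rewrite !(ltr0_norm y0) in y1 ys n0 *.
  have sy : 0 <= y + s by lra.
  have := hC (y + s) (- y) sy; rewrite n0 (ltW y1) => /(_ isT).
  have := hK (y + s) (- y) sy n0.
  have -> : y + s - y = s by ring.
  move: (g (y + s)) (g s) (h (y + s)) (h s) => gy gs hy hs.
  rewrite mulNr opprK !ler_norml => /andP[a1 a2] /andP[b1 b2].
  by apply/andP; split; nra.
split; first by apply/cvg_ex; exists (h s).
exact: cvg_lim.
Qed.

Lemma lip_continuous h (C : R) :
  (forall s delta, 0 <= s -> 0 < delta <= 1 ->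
     `|h (s + delta) - h s| <= C * delta) ->
  forall s : R, 0 < s -> {for s, continuous h}.
Proof.
move=> hC s s0; apply/cvgrPdist_le => e e0.
have C0 : 0 <= C.
  by have := hC 0 1 (lexx _); rewrite lexx ltr01 mulr1 => /(_ isT); apply: le_trans.
pose r := Num.min 1 (Num.min s (e / (C + 1))).
have C1 : 0 < C + 1 by lra.
have r0 : 0 < r by rewrite !lt_min ltr01 s0 divr_gt0.
apply/nbhs_ballP; exists r => //= y; rewrite /ball/=.
rewrite !lt_min => /and3P[y1 ys ye].
rewrite ltr_pdivlMr// in ye.
have ye' : C * `|s - y| <= e by have := normr_ge0 (s - y); nra.
apply: le_trans ye'.
have [sy|sy|->] := ltgtP s y; last by rewrite !subrr !normr0 mulr0.
- have e1 : `|s - y| = y - s by rewrite ltr0_norm ?subr_lt0// opprB.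
  have := hC s (y - s) (ltW s0); rewrite subrKC subr_gt0 sy -e1 (ltW y1) distrC.
  exact.
- rewrite gtr0_norm ?subr_gt0// in y1 ys *.
  have := hC y (s - y); rewrite subrKC subr_gt0 sy (ltW y1)/=; apply => //; lra.
Qed.

(** The fundamental theorem of calculus on a compact interval whose endpoints
    lie outside of the support. *)
Lemma integral_of_derive F p (C t0 t1 : R) : 0 < t0 -> first_order F p ->
  (forall s delta, 0 <= s -> 0 < delta <= 1 ->
     `|p (s + delta) - p s| <= C * delta) ->
  (forall t, ~~ (t0 <= t <= t1) -> F t = 0 /\ p t = 0) ->
  \int[lebesgue_measure]_(t in `]0, +oo[) p t = 0.
Proof.
move=> t00 Fp pC supp.
(* The support in time may be empty, hence the maximum. *)
pose u := t0 / 2; pose v := Num.max t0 t1 + 1.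
have u0 : 0 < u by rewrite divr_gt0.
have ut : u < t0 by rewrite /u; lra.
have tv : t1 < v by apply: (@le_lt_trans _ _ (Num.max t0 t1)); rewrite ?ltrDl// le_max lexx orbT.
have uv : u < v by apply: (lt_le_trans ut); rewrite /v -[leLHS]addr0 lerD// le_max lexx.
have Fd := first_order_is_derive Fp pC.
have pc := lip_continuous pC.
have -> : \int[lebesgue_measure]_(t in `]0, +oo[) p t =
    \int[lebesgue_measure]_(t in `[u, v]) p t.
  rewrite Rintegral_mkcond [RHS]Rintegral_mkcond; congr (Rintegral _ _ _).
  apply/funext => t; rewrite !patchE.
  have [h|h] := boolP (t0 <= t <= t1).
    have /andP[h0 h1] := h.
    rewrite !mem_set//= in_itv/=; last by rewrite andbT; lra.
    by apply/andP; split; lra.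
  by rewrite (supp t h).2; do 2 case: ifP.
have pos x : x \in `[u, v] -> 0 < x.
  by rewrite in_itv/= => /andP[ux _]; apply: lt_le_trans ux.
have Fc x : x \in `[u, v] -> {for x, continuous F}.
  move=> /pos x0; apply: differentiable_continuous; apply/derivable1_diffP.
  by have [] := Fd x x0.
rewrite /Rintegral (@continuous_FTC2 _ _ F) //.
- have [-> _] : F u = 0 /\ p u = 0 by apply: supp; rewrite negb_and -ltNge ut.
  have [-> _] : F v = 0 /\ p v = 0 by apply: supp; rewrite negb_and -!ltNge tv orbT.
  by rewrite -EFinB subrr.
- apply: continuous_in_subspaceT => x /[1!inE] /= /pos; exact: pc.
- split.
  + by move=> x /subset_itv_oo_cc /pos x0; have [] := Fd x x0.
  + by apply: cvg_at_right_filter; apply: Fc; rewrite in_itv/= lexx ltW.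
  + by apply: cvg_at_left_filter; apply: Fc; rewrite in_itv/= lexx ltW.
- move=> x /subset_itv_oo_cc /pos x0; rewrite derive1E.
  by have [] := Fd x x0.
Qed.

End FirstOrder.

(** * The linear combination of telegraph processes *)

Section TelegraphSum.
Context (R : realType) (d : measure_display) (T : measurableType d).
Variable P : probability T R.
Variables (n : nat) (c lam x0 a : 'I_n -> R).
Hypothesis hlam : forall k, 0 < lam k.
Variables (D0 : 'I_n -> T -> R) (N : 'I_n -> R -> T -> nat).
Hypothesis hD0 : forall k, initial_direction P (D0 k).
Hypothesis hN : forall k, poisson_process P (lam k) (N k).
Hypothesis hindep : independent_telegraph_data P D0 N.

Let D := fun k => direction (D0 k) (N k).
Let X := fun k => telegraph (c k) (x0 k) (D0 k) (N k).
Let L := lin_comb a X.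
Local Notation drift := (drift a c).
Local Notation op := (op_mx a c lam).

Definition state (k : 'I_(2 ^ n)) (t : R) : set T :=
  [set w | forall j, D j t w = (sigma k j)%:~R].

(** The position at time [s] computed from grid signs, each integral being
    replaced by its Riemann sum. *)
Definition grid_position (s : R) m (v : {ffun 'I_n * 'I_m.+2 -> bool}) : R :=
  \sum_(k < n) a k * (x0 k + c k *
    \sum_(i < m.+1) s / m.+1%:R * sign_value R (v (k, widen_ord (leqnSn _) i))).

Definition grid_state (k : 'I_(2 ^ n)) m
    (v : {ffun 'I_n * 'I_m.+2 -> bool}) : bool :=
  [forall j, sign_value R (v (j, ord_max)) == (sigma k j)%:~R].

Section AtTime.
Variables (s delta : R).
Hypotheses (s0 : 0 <= s) (delta0 : 0 <= delta).

Let sg m w := signs D0 N s delta m w.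

Lemma grid_positionE m w : grid_position s (sg m w) =
  \sum_(k < n) a k * (x0 k + c k *
     riemann (D0 k w) (fun t => N k t w) m s).
Proof.
apply: eq_bigr => k _; congr (_ * (_ + _ * _)); apply: eq_bigr => i _.
congr (_ * _); rewrite -(signs_direction N hD0 s delta w k).
by rewrite /= /grid_time ltnW// ltnS ltnW.
Qed.

Lemma grid_position_cvg w : grid_position s (sg m w) @[m --> \oo] --> L s w.
Proof.
under eq_fun do rewrite grid_positionE.
rewrite /L /lin_comb; apply: cvg_big => [|k _]; first exact: add_continuous.
apply: cvgMr; apply: cvgD; first exact: cvg_cst.
apply: cvgMr; apply: (@riemann_cvg R (D0 k w) (fun t => N k t w)) => //.
  exact: (direction_values (hD0 k)).
by move=> u v u0 uv; exact: (poisson_mono (hN k)).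
Qed.

Lemma grid_stateE k m w : grid_state k (sg m w) = (w \in state k s).
Proof.
apply/forallP/idP => [h|/[1!inE] h j].
  rewrite inE => j; have /eqP <- := h j.
  rewrite -(signs_direction N hD0 s delta w j)/= /grid_time.
  by rewrite ltnSn mulrC divfK.
rewrite -h -(signs_direction N hD0 s delta w j)/= /grid_time.
by rewrite ltnSn mulrC divfK.
Qed.

Lemma measurable_grid m (f : {ffun 'I_n * 'I_m.+2 -> bool} -> R) :
  measurable_fun setT (fun w => f (sg m w)).
Proof.
have -> : (fun w => f (sg m w)) = fun w => \sum_v f v * \1_[set w | sg m w = v] w.
  apply/funext => w.
  rewrite (bigD1 (sg m w))//= indicE mem_set// mulr1 big1 ?addr0// => v vn.
  by rewrite indicE memNset ?mulr0//= => e; rewrite e eqxx in vn.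
apply: (@bounded_rv_sum _ _ _ _ _ _ _).1 => v.
exact/bounded_rvZ/bounded_rv_indic/(measurable_signs hD0 hN).
Qed.

Lemma measurable_position : measurable_fun setT (L s).
Proof.
apply: (@measurable_fun_cvg _ _ _ _ (fun m w => grid_position s (sg m w))).
  by move=> m; exact: measurable_grid.
by move=> w _; exact: grid_position_cvg.
Qed.

Lemma measurable_state k : measurable (state k s).
Proof.
apply/(@measurable_indicP _ _ R).
rewrite (_ : \1__ = fun w => (grid_state k (sg 0 w))%:R :> R); last first.
  by apply/funext => w; rewrite grid_stateE indicE.
exact: (@measurable_grid 0 (fun v => (grid_state k v)%:R)).
Qed.

Lemma bounded_rv_state k (psi : R -> R) (M : R) : continuous psi ->
  (forall x, `|psi x| <= M) ->
  bounded_rv (fun w => \1_(state k s) w * psi (L s w)).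
Proof.
move=> cpsi bpsi; apply: bounded_rvM.
  exact/bounded_rv_indic/measurable_state.
split; last by exists M.
apply: measurableT_comp; last exact: measurable_position.
exact: continuous_measurable_fun.
Qed.

(** The position is a limit of functions of the grid signs, for which the
    product formula is [expect_signs_indep]; both sides pass to the limit by
    dominated convergence. *)
Lemma expect_state_indep k (psi : R -> R) (M : R) (C : 'I_n -> set nat) :
  continuous psi -> (forall x, `|psi x| <= M) ->
  expect P (fun w => \1_(incr_event N s delta C) w *
     (\1_(state k s) w * psi (L s w))) =
  (\prod_(j < n) fine (P (incr (N j) s (s + delta) @^-1` C j))) *
  expect P (fun w => \1_(state k s) w * psi (L s w)).
Proof.
move=> cpsi bpsi.
pose f m (v : {ffun 'I_n * 'I_m.+2 -> bool}) :=
  (grid_state k v)%:R * psi (grid_position s v).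
have M0 : 0 <= M by apply: le_trans (bpsi 0).
have bf m v : `|@f m v| <= M.
  rewrite normrM normr_nat; case: grid_state; rewrite ?mul1r ?mul0r//.
have cf w : @f m (sg m w) @[m --> \oo] --> \1_(state k s) w * psi (L s w).
  have -> : (fun m => @f m (sg m w)) =
      fun m => \1_(state k s) w * psi (grid_position s (sg m w)).
    by apply/funext => m; rewrite /f grid_stateE -indicE.
  by apply: cvgMr; apply: (cvg_comp _ psi (@grid_position_cvg w)); exact: cpsi.
have mC := measurable_incr_event hN s0 delta0 C.
have c1 := @expect_cvg _ _ _ P
  (fun m w => \1_(incr_event N s delta C) w * @f m (sg m w))
  (fun w => \1_(incr_event N s delta C) w * (\1_(state k s) w * psi (L s w))) M.
have c2 := @expect_cvg _ _ _ P (fun m w => @f m (sg m w))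
  (fun w => \1_(state k s) w * psi (L s w)) M.
have {}c2 := c2 (fun m => measurable_grid _) (fun m w => bf m _) cf.
set q := \prod_(j < n) _.
have e m : expect P (fun w => \1_(incr_event N s delta C) w * @f m (sg m w)) =
    q * expect P (fun w => @f m (sg m w)).
  exact: (expect_signs_indep hD0 hN hindep s0 delta0).
have c3 : expect P (fun w => \1_(incr_event N s delta C) w * @f m (sg m w))
    @[m --> \oo] --> q * expect P (fun w => \1_(state k s) w * psi (L s w)).
  by under eq_fun do rewrite e; apply: cvgMr.
apply: (cvg_unique _ _ c3) => //.
apply: c1.
- move=> m; apply: measurable_funM; first exact: measurable_indic.
  exact: measurable_grid.
- move=> m w; rewrite normrM indicE normr_nat.
  by case: (_ \in _); rewrite ?mul1r ?mul0r.
- by move=> w; apply: cvgMr; exact: cf.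
Qed.

End AtTime.


(** The pairing of [f_k (., t)] with [f (., t)], where [f_k] is the density of
    the position on the event that the directions are [sigma k]. *)
Definition phase_mean (k : 'I_(2 ^ n)) (f : R * R -> R) (t : R) : R :=
  expect P (fun w => \1_(state k t) w * f (L t w, t)).

Definition speed_bound : R := \sum_k `|a k * c k|.

Lemma speed_bound_ge0 : 0 <= speed_bound.
Proof. by apply: sumr_ge0. Qed.

Lemma drift_le_speed k : `|drift k| <= speed_bound.
Proof.
apply: le_trans (ler_norm_sum _ _ _) _; apply: ler_sum => j _.
rewrite mulrAC normrM /sigma; case: odd; first by rewrite normr1 mulr1.
by rewrite rmorphN1 normrN1 mulr1.
Qed.

Section Step.
Variables (s delta : R).
Hypotheses (s0 : 0 <= s) (delta0 : 0 < delta).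

Let ds : s <= s + delta. Proof. by rewrite lerDl ltW. Qed.
Let t0 : 0 <= s + delta. Proof. exact: le_trans ds. Qed.
Let d0 : 0 <= delta. Proof. exact: ltW. Qed.

Lemma position_lip w : `|L (s + delta) w - L s w| <= speed_bound * delta.
Proof.
rewrite /L /lin_comb -sumrB /speed_bound mulr_suml.
apply: le_trans (ler_norm_sum _ _ _) _; apply: ler_sum => k _.
rewrite -mulrBr /X /telegraph opprD addrACA subrr add0r -mulrBr mulrA normrM ler_wpM2l//.
apply: le_trans (sign_integral_lip (direction_values (hD0 k) w)
  (N := fun t => N k t w) (poisson_mono (hN k) w) s0 ds) _.
by rewrite (addrC s) addrK.
Qed.

Lemma position_no_jump k w : w \in state k s ->
  (forall j, incr (N j) s (s + delta) w = 0%N) ->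
  L (s + delta) w - L s w = delta * drift k.
Proof.
rewrite inE => hw h0; rewrite /L /lin_comb -sumrB mulr_sumr.
apply: eq_bigr => j _.
rewrite -mulrBr /X /telegraph opprD addrACA subrr add0r -mulrBr.
have e : N j s w = N j (s + delta) w.
  apply/eqP; rewrite eqn_leq (poisson_mono (hN j))//=.
  by move/eqP: (h0 j); rewrite subn_eq0.
have := sign_integral_const (direction_values (hD0 j) w)
  (N := fun t => N j t w) (poisson_mono (hN j) w) s0 ds e.
have -> : D0 j w * (-1) ^+ N j s w = (sigma k j)%:~R by exact: hw.
by move=> ->; rewrite (addrC s) addrK; ring.
Qed.

(** Parities of the increments that lead from the sign vector [sigma m] to
    [sigma k]. *)
Definition flip_set (k m : 'I_(2 ^ n)) (j : 'I_n) : set nat :=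
  [set i | odd i = (sigma k j != sigma m j)].

Lemma direction_step j w : D j (s + delta) w =
  D j s w * (-1) ^+ odd (incr (N j) s (s + delta) w).
Proof.
rewrite /D /direction -mulrA signr_odd -exprD /incr subnKC//.
exact: (poisson_mono (hN j)).
Qed.

Lemma sigma_flip (k m : 'I_(2 ^ n)) j (b : bool) :
  ((sigma m j)%:~R * (-1) ^+ b == (sigma k j)%:~R :> R) =
  (b == (sigma k j != sigma m j)).
Proof.
have n11 : (-1 : R) == 1 = false by apply: lt_eqF; lra.
rewrite /sigma; do 2 case: odd; case: b;
  by rewrite ?expr0 ?expr1 ?rmorphN1 ?rmorph1 ?mulr1 ?mulrN1 ?opprK ?eqxx
    ?n11 1?eq_sym ?n11.
Qed.

Lemma state_cover w : exists m, w \in state m s.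
Proof.
have [m hm] := @sigma_onto n (fun j => D j s w == 1).
exists m; rewrite inE => j; rewrite hm.
have := direction_sg N hD0 w j s; rewrite /sign_value /D => ->.
by case: (_ == 1); rewrite ?eqxx ?rmorph1 ?rmorphN1//; case: eqP.
Qed.

Lemma state_unique w m m' : w \in state m s -> w \in state m' s -> m = m'.
Proof.
rewrite !inE => hm hm'; apply: sigma_inj => j; apply/eqP.
by rewrite -(eqr_int R) -hm hm'.
Qed.

Lemma state_step k m w : w \in state m s ->
  (w \in state k (s + delta)) =
  (w \in incr_event N s delta (fun j => flip_set k m j)).
Proof.
rewrite inE => hm; apply/idP/idP; rewrite !inE => h j.
  have := direction_step j w; rewrite [D j s w]hm [LHS]h => /esym/eqP.
  by rewrite sigma_flip => /eqP.
apply: etrans (direction_step j w) _; rewrite [D j s w]hm.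
by apply/eqP; rewrite sigma_flip; apply/eqP; exact: h.
Qed.

(** The sign vector at time [s] is one of the [sigma m], and the parities of
    the increments determine the later one. *)
Lemma state_decomposition k w : \1_(state k (s + delta)) w =
  \sum_m \1_(incr_event N s delta (fun j => flip_set k m j)) w *
          \1_(state m s) w :> R.
Proof.
have [m hm] := state_cover w.
rewrite (bigD1 m)//= big1 => [|m' mm'].
  by rewrite !indicE hm mulr1 addr0 (state_step _ hm).
rewrite [X in _ * X]indicE (_ : _ \in _ = false) ?mulr0//.
by apply/negbTE; apply: contra mm' => hm'; rewrite (state_unique hm hm').
Qed.

(** A number that is at least 1 as soon as some process jumps, and whose mean
    is [O(delta)] because a union bound is built in. *)
Definition jump_count w : R := \sum_j \1_(incr (N j) s (s + delta) @^-1` [set i | (0 < i)%N]) w.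

Let measurable_incr_preimage j C : measurable (incr (N j) s (s + delta) @^-1` C).
Proof. by rewrite -[_ @^-1` _]setTI; apply: (measurable_incr (hN j)). Qed.

Lemma bounded_jump_count : bounded_rv jump_count.
Proof. by apply: bounded_rv_sum => j; exact: bounded_rv_indic. Qed.

Lemma expect_jump_count : expect P jump_count <= (\sum_j lam j) * delta.
Proof.
rewrite expect_sum => [|j]; last exact: bounded_rv_indic.
rewrite mulr_suml; apply: ler_sum => j _; rewrite expect_indic//.
exact: (prob_jump (hlam j) (hN j)).
Qed.

Lemma jump_count_ge0 w : 0 <= jump_count w.
Proof. by apply: sumr_ge0 => j _; rewrite indicE. Qed.

Lemma jump_count_ge1 w : (exists j, incr (N j) s (s + delta) w != 0%N) ->
  1 <= jump_count w.
Proof.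
case=> j hj; rewrite /jump_count (bigD1 j)//= indicE mem_set/= ?lt0n//.
by rewrite lerDl; apply: sumr_ge0 => i _; rewrite indicE.
Qed.

(** Without jumps the displacement is exactly [delta * drift k]; with a jump
    the error is still [O(delta)], so that its mean is [O(delta ^ 2)]. *)
Lemma displacement_error k w :
  \1_(state k (s + delta)) w * `|L (s + delta) w - (L s w + delta * drift k)|
    <= 2 * speed_bound * delta * jump_count w.
Proof.
have [hj|/existsPn hj] := boolP [exists j, incr (N j) s (s + delta) w != 0%N].
  have /existsP/jump_count_ge1 h1 := hj.
  apply: (@le_trans _ _ (2 * speed_bound * delta)); last first.
    by rewrite ler_peMr// !mulr_ge0 ?speed_bound_ge0.
  apply: (@le_trans _ _ `|L (s + delta) w - (L s w + delta * drift k)|).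
    by rewrite ler_piMl// indicE; case: (_ \in _).
  rewrite opprD addrA; apply: le_trans (ler_normB _ _) _.
  have h2 := position_lip w.
  have h3 : `|delta * drift k| <= speed_bound * delta.
    by rewrite normrM (ger0_norm d0) mulrC ler_wpM2r// drift_le_speed.
  lra.
have h0 j : incr (N j) s (s + delta) w = 0%N.
  by apply/eqP; have := hj j; rewrite negbK.
have r0 : 0 <= 2 * speed_bound * delta * jump_count w.
  by rewrite !mulr_ge0 ?speed_bound_ge0 ?jump_count_ge0.
rewrite indicE; have [hw|_] := boolP (w \in state k (s + delta)); last by rewrite mul0r.
have hs : w \in state k s.
  rewrite inE => j; have := hw; rewrite inE => /(_ j).
  by rewrite -/(D j _ w) direction_step h0 expr0 mulr1.
by rewrite opprD addrA (position_no_jump hs h0) subrr normr0 mulr0.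
Qed.

Definition transition_prob (k m : 'I_(2 ^ n)) : R :=
  \prod_j fine (P (incr (N j) s (s + delta) @^-1` flip_set k m j)).

(** The matrix of transition probabilities is [1 - delta * Lambda_mx] to first
    order. *)
Lemma transition_prob_approx k m :
  `|transition_prob k m - ((k == m)%:R - delta * Lambda_mx lam k m)|
     <= 2 * (\sum_j lam j) ^+ 2 * delta ^+ 2.
Proof.
pose A := [set j | sigma k j != sigma m j]%SET.
pose q j := fine (P (incr (N j) s (s + delta) @^-1` [set i | odd i])).
have tE : transition_prob k m = \prod_j (if j \in A then q j else 1 - q j).
  apply: eq_bigr => j _; rewrite inE /q.
  rewrite -(prob_incrC (hN j) s0 delta0); case: ifP => h; congr (fine (P (_ @^-1` _))).
    by apply/seteqP; split=> i; rewrite /flip_set/= h.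
  by apply/seteqP; split=> i; rewrite /flip_set/= h; [move=> ->|move/negP/negbTE].
have A0 : (A == finset.set0) = (k == m).
  apply/eqP/eqP => [e|e]; last by apply/finset.setP => j; rewrite !inE e eqxx.
  apply: sigma_inj => j; apply/eqP; apply/negPn; move/finset.setP/(_ j): e.
  by rewrite !inE => ->.
have := prod_switch_first_order A d0 (fun j => ltW (hlam j))
  (fun j => prob_incr_bounds (hN j) s0 delta0 [set i | odd i])
  (fun j => prob_odd_le (hlam j) (hN j) s0 delta0)
  (fun j => prob_odd_approx (hlam j) (hN j) s0 delta0).
rewrite -/(q _) -tE A0.
have -> // : delta * (if #|A| == 1%N then \sum_(i in A) lam i
    else if k == m then - \sum_i lam i else 0) = - (delta * Lambda_mx lam k m).
(* The set counted by [hamming] is a predicate, the set [A] a finite set. *)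
have hE : hamming k m = #|A|.
  by apply: eq_card => j; apply/idP/idP; rewrite !inE.
rewrite -mulrN; congr (_ * _); rewrite mxE hE.
have [e|kn] := eqVneq k m.
  have -> : A = finset.set0 by apply/eqP; rewrite A0 e eqxx.
  by rewrite cards0.
case: ifP => _; rewrite ?oppr0// opprK.
by apply: eq_bigl => j; rewrite inE.
Qed.

End Step.

Lemma bounded_rv_phase k (f : R * R -> R) t : 0 <= t -> test_function f ->
  bounded_rv (fun w => \1_(state k t) w * f (L t w, t)).
Proof.
move=> t0 hf; have [M hM] := test_function_bounded [::] hf.
have := @bounded_rv_state t 0 t0 (lexx _) k
  (fun x => f (x + 0, t)) M.
under [X in _ -> _ -> bounded_rv X]eq_fun do rewrite addr0.
apply; last by move=> x; exact: hM.
by apply: smooth2_slice_continuous; case: hf.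
Qed.

Lemma phase_mean_bounded (f : R * R -> R) (M : R) : test_function f ->
  (forall z, `|f z| <= M) -> forall k t, 0 <= t -> `|phase_mean k f t| <= M.
Proof.
move=> hf hM k t t0; apply: le_norm_expect_cst; first exact: bounded_rv_phase.
move=> w; rewrite normrM indicE normr_nat.
by case: (_ \in _); rewrite ?mul1r// mul0r; exact: le_trans (hM (0, 0)).
Qed.

(** The position at time [s + delta] is replaced by [L s + delta * drift k],
    which depends on the past only; the future then enters through parities
    alone, and independence turns the mean into a sum over the sign vectors at
    time [s]. *)
Lemma phase_mean_step (f : R * R -> R) (M : R) : test_function f ->
  (forall s z, (size s <= 2)%N -> `|partials s f z| <= M) ->
  forall k s delta, 0 <= s -> 0 < delta ->
  `|phase_mean k f (s + delta) - \sum_m transition_prob s delta k m *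
      expect P (fun w => \1_(state m s) w *
                 f (L s w + delta * drift k, s + delta))|
    <= M * (2 * speed_bound * delta) * ((\sum_j lam j) * delta).
Proof.
move=> hf hM k s delta s0 delta0.
have [sf _ _] := hf.
have d0 : 0 <= delta by exact: ltW.
have t0 : 0 <= s + delta by rewrite addr_ge0.
have M0 : 0 <= M by apply: le_trans (hM [::] (0, 0) isT).
pose psi x := f (x + delta * drift k, s + delta).
have cpsi : continuous psi by exact: smooth2_slice_continuous.
have bpsi x : `|psi x| <= M by exact: (hM [::]).
have bS m : bounded_rv (fun w => \1_(state m s) w * psi (L s w)).
  exact: (bounded_rv_state s0 d0 m cpsi bpsi).
have bO m : bounded_rv (\1_(incr_event N s delta (fun j => flip_set k m j)) : T -> R).
  exact/bounded_rv_indic/(measurable_incr_event hN s0 d0).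
rewrite [X in _ - X](_ : _ =
    expect P (fun w => \1_(state k (s + delta)) w * psi (L s w))); last first.
  transitivity (\sum_m expect P (fun w =>
      \1_(incr_event N s delta (fun j => flip_set k m j)) w *
      (\1_(state m s) w * psi (L s w)))).
    apply: eq_bigr => m _.
    by rewrite (expect_state_indep s0 d0 m _ cpsi bpsi).
  rewrite -expect_sum; last by move=> m; exact: bounded_rvM.
  congr expect; apply/funext => w.
  rewrite (state_decomposition s0 delta0) mulr_suml.
  by apply: eq_bigr => m _; rewrite mulrA.
have bL : bounded_rv (fun w => \1_(state k (s + delta)) w * psi (L s w)).
  apply: bounded_rvM; first exact/bounded_rv_indic/(measurable_state t0 (lexx 0)).
  split; last by exists M.
  apply: measurableT_comp; first exact: continuous_measurable_fun.
  exact: (measurable_position s0 d0).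
have bM := bounded_rv_phase k t0 hf.
rewrite /phase_mean -expectB//.
have bJ := bounded_jump_count s0 delta0.
apply: (@le_trans _ _ (expect P (fun w => M * (2 * speed_bound * delta) * jump_count s delta w))).
  apply: le_norm_expect; [exact: bounded_rvB|exact: bounded_rvZ|move=> w].
  rewrite -mulrBr normrM [X in X * _]ger0_norm ?indicE//.
  have lipx := lipschitz_of_derive (smooth2_is_derive_dx sf (s + delta))
     (fun y => hM [:: false] _ isT) (L s w + delta * drift k) (L (s + delta) w).
  rewrite -indicE; apply: le_trans (ler_wpM2l _ lipx) _; first by rewrite indicE.
  rewrite mulrCA -!mulrA ler_wpM2l// !mulrA.
  exact: (displacement_error s0 delta0 k w).
rewrite expectZ// ler_wpM2l//.
  by rewrite mulr_ge0// !mulr_ge0 ?speed_bound_ge0.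
exact: (expect_jump_count s0 delta0).
Qed.

(** In [phase_mean_step], transition probabilities are expanded to first order;
    the test function is expanded to first order in the diagonal term and to
    order 0 in the others, which already carry a factor [delta]. *)
Lemma phase_mean_first_order (f : R * R -> R) k : test_function f ->
  first_order (phase_mean k f) (fun s => phase_mean k (dt f) s + drift k * phase_mean k (dx f) s
    - \sum_m Lambda_mx lam k m * phase_mean m f s).
Proof.
move=> hf; have [M hM] := test_function_bounded_upto 2 hf.
have [sf _ _] := hf.
have M0 : 0 <= M by apply: le_trans (hM [::] (0, 0) isT).
have A0 := speed_bound_ge0.
pose S := \sum_j lam j.
have S0 : 0 <= S by apply: sumr_ge0 => j _; exact: ltW.
pose K1 := M * (2 * speed_bound) * S.
pose K2 := \sum_(m < 2 ^ n) 2 * S ^+ 2 * M.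
pose K3 := M * (speed_bound + 1) ^+ 2.
pose K4 := \sum_m `|Lambda_mx lam k m| * (M * (speed_bound + 1)).
(* [K1]: displacement; [K2]: transition probabilities; [K3]: Taylor expansion
   in the diagonal term; [K4]: shift of the argument in the rate terms. *)
exists (K1 + K2 + K3 + K4) => s delta s0 delta0.
have d0 : 0 <= delta by exact: ltW.
pose e m := expect P (fun w => \1_(state m s) w *
  f (L s w + delta * drift k, s + delta)).
have step1 := phase_mean_step hf hM k s0 delta0.
pose psi x := f (x + delta * drift k, s + delta).
have cpsi : continuous psi by exact: smooth2_slice_continuous.
have bpsi x : `|psi x| <= M by exact: (hM [::]).
have bS m : bounded_rv (fun w => \1_(state m s) w * psi (L s w)).
  exact: (bounded_rv_state s0 d0 m cpsi bpsi).
have bG m g : test_function g -> bounded_rv (fun w => \1_(state m s) w * g (L s w, s)).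
  exact: bounded_rv_phase.
have ind_le (B : set T) w (x y : R) : `|x| <= y -> `|\1_B w * x| <= y.
  move=> xy; rewrite normrM indicE normr_nat.
  by case: (_ \in _); rewrite ?mul1r// mul0r; exact: le_trans xy.
have eM m : `|e m| <= M.
  by apply: le_norm_expect_cst; [exact: bS|move=> w; apply: ind_le; exact: (hM [::])].
have shift_le : `|delta * drift k| <= delta * speed_bound.
  by rewrite normrM (gtr0_norm delta0) ler_wpM2l// drift_le_speed.
have step2 : `|\sum_m transition_prob s delta k m * e m -
    \sum_m ((k == m)%:R - delta * Lambda_mx lam k m) * e m| <= K2 * delta ^+ 2.
  rewrite -sumrB /K2 mulr_suml; apply: le_trans (ler_norm_sum _ _ _) _.
  apply: ler_sum => m _; rewrite -mulrBl normrM mulrAC.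
  by apply: ler_pM => //; exact: (transition_prob_approx s0 delta0).
have step3 : `|e k - phase_mean k f s -
      delta * (phase_mean k (dt f) s + drift k * phase_mean k (dx f) s)|
    <= K3 * delta ^+ 2.
  have tdt : test_function (dt f) := test_function_partials [:: true] hf.
  have tdx : test_function (dx f) := test_function_partials [:: false] hf.
  have b1 := bounded_rvB (bS k) (bG k f hf).
  have b2 := bounded_rvD (bounded_rvZ delta (bG k _ tdt))
     (bounded_rvZ (delta * drift k) (bG k _ tdx)).
  have -> : e k - phase_mean k f s -
      delta * (phase_mean k (dt f) s + drift k * phase_mean k (dx f) s) =
    expect P (fun w => (\1_(state k s) w * psi (L s w) - \1_(state k s) w * f (L s w, s))
      - (delta * (\1_(state k s) w * dt f (L s w, s)) +
         delta * drift k * (\1_(state k s) w * dx f (L s w, s)))).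
    rewrite expectB// expectB//; last exact: bG.
    rewrite expectD; try exact/bounded_rvZ/bG.
    by rewrite !expectZ; try exact: bG; rewrite mulrDr mulrA.
  apply: le_norm_expect_cst; first exact: bounded_rvB.
  move=> w; pose x := L s w.
  have -> : \1_(state k s) w * psi (L s w) - \1_(state k s) w * f (L s w, s)
      - (delta * (\1_(state k s) w * dt f (L s w, s)) +
         delta * drift k * (\1_(state k s) w * dx f (L s w, s))) =
    \1_(state k s) w * (psi x - f (x, s) -
       (delta * drift k * dx f (x, s) + delta * dt f (x, s))).
    rewrite -/x; move: (\1__ w) (psi x) (f (x, s)) (dt f (x, s)) (dx f (x, s)).
    by clear => i p q u v; ring.
  apply: ind_le.
  have tay := taylor2 sf (fun s z h => hM s z (eq_leq h)) x s (delta * drift k) delta.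
  apply: le_trans tay _; rewrite /K3 -mulrA -exprMn ler_wpM2l//.
  rewrite ler_sqr ?nnegrE ?addr_ge0 ?mulr_ge0 ?addr_ge0//.
  by rewrite (gtr0_norm delta0); lra.
have step4 m : `|e m - phase_mean m f s| <= M * (speed_bound + 1) * delta.
  rewrite -expectB//; last exact: bG.
  apply: le_norm_expect_cst; first by apply: bounded_rvB => //; exact: bG.
  move=> w; rewrite -mulrBr; apply: ind_le.
  have hM1 l z : size l = 1%N -> `|partials l f z| <= M.
    by move=> h; apply: hM; rewrite h.
  have lip := lipschitz2 sf hM1 (L s w) s (delta * drift k) delta.
  apply: le_trans lip _; rewrite -mulrA ler_wpM2l// (gtr0_norm delta0); lra.
have step5 : `|\sum_m Lambda_mx lam k m * e m - \sum_m Lambda_mx lam k m * phase_mean m f s|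
    <= K4 * delta.
  rewrite -sumrB /K4 mulr_suml; apply: le_trans (ler_norm_sum _ _ _) _.
  by apply: ler_sum => m _; rewrite -mulrBr normrM -mulrA ler_wpM2l.
have expand : \sum_m ((k == m)%:R - delta * Lambda_mx lam k m) * e m =
    e k - delta * \sum_m Lambda_mx lam k m * e m.
  under eq_bigr do rewrite mulrBl -mulrA.
  rewrite sumrB -mulr_sumr (bigD1 k)//= eqxx mul1r big1 ?addr0// => m.
  by rewrite eq_sym => /negPf ->; rewrite mul0r.
rewrite expand in step2.
have step5' : `|delta * \sum_m Lambda_mx lam k m * e m -
    delta * \sum_m Lambda_mx lam k m * phase_mean m f s| <= K4 * delta ^+ 2.
  by rewrite -mulrBr normrM (gtr0_norm delta0) expr2 mulrA mulrC ler_wpM2r.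
have {}step1 : `|phase_mean k f (s + delta) - \sum_m transition_prob s delta k m * e m|
    <= K1 * delta ^+ 2.
  by apply: le_trans step1 _; rewrite /K1 -/S le_eqVlt; apply/orP; left; apply/eqP; ring.
move: step1 step2 step3 step5'; clear.
move: (phase_mean k f _) (phase_mean k f s) (phase_mean k (dt f) s).
move: (phase_mean k (dx f) s) (drift k) (e k).
move: (\sum_m _ * e m) (\sum_m _ * e m) (\sum_m _ * phase_mean m f s) (delta ^+ 2).
move=> p q r d2 gx dr ek g1 g0 gt.
rewrite !ler_norml => /andP[? ?] /andP[? ?] /andP[? ?] /andP[? ?].
by apply/andP; split; lra.
Qed.

Lemma f_density_phase_mean k t (f : R * R -> R) :
  f_density P L D k t (fun x => f (x, t)) = phase_mean k f t.
Proof.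
rewrite /f_density Rintegral_mkcond; congr (Rintegral _ _ _).
apply/funext => w; rewrite patchE indicE /state.
by case: (_ \in _); rewrite ?mul1r ?mul0r.
Qed.

Lemma phase_mean_eq0 k t (f : R * R -> R) :
  (forall x, f (x, t) = 0) -> phase_mean k f t = 0.
Proof.
move=> f0; rewrite -(expect_cst P 0); congr expect.
by apply/funext => w; rewrite f0 mulr0.
Qed.

Lemma phase_mean_sum (I : finType) (F : I -> R * R -> R) m t : 0 <= t ->
  (forall i, test_function (F i)) ->
  phase_mean m (fun z => \sum_i F i z) t = \sum_i phase_mean m (F i) t.
Proof.
move=> t0 hF; rewrite /phase_mean -expect_sum; last first.
  by move=> i; apply: bounded_rv_phase.
by congr expect; apply/funext => w; rewrite mulr_sumr.
Qed.

Lemma phase_mean_adjoint_op k m Q f t : 0 <= t -> test_function f ->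
  phase_mean m (adjoint_op (op k m * Q) f) t =
  (if k == m then - phase_mean m (dt (adjoint_op Q f)) t
       - drift k * phase_mean m (dx (adjoint_op Q f)) t else 0)
  + Lambda_mx lam k m * phase_mean m (adjoint_op Q f) t.
Proof.
move=> t0 hf; have [sf _ _] := hf.
have hQ := adjoint_op_test Q hf.
have E w := adjoint_op_mx a c lam k m Q (L t w, t) sf.
have bf := bounded_rv_phase m t0 hQ.
have [km|km] := eqVneq k m; last first.
  rewrite (negPf km) in E; rewrite add0r -(expectZ _ _ bf).
  congr expect; apply/funext => w.
  by apply: etrans (congr1 _ (E w)) _; rewrite add0r mulrCA.
have bt := bounded_rv_phase m t0 (test_function_partials [:: true] hQ).
have bx := bounded_rv_phase m t0 (test_function_partials [:: false] hQ).
have C := expect_comb3 P (drift k) (Lambda_mx lam k m) bt bx bf.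
apply: etrans C; congr expect; apply/funext => w.
have := E w; rewrite km eqxx => e; apply: etrans (congr1 _ e) _ => /=.
move: (\1__ w) (dt _ _) (dx _ _) (adjoint_op _ _ _) (drift _) (Lambda_mx _ _ _).
by clear => *; ring.
Qed.

(** Row [k] of the system [M f = 0], tested against the image of [f] under the
    adjoint of [Q]. *)
Lemma phase_mean_adjoint_first_order k Q f : test_function f ->
  first_order (phase_mean k (adjoint_op Q f))
    (fun t => - \sum_m phase_mean m (adjoint_op (op k m * Q) f) t).
Proof.
move=> hf; have [K hK] := phase_mean_first_order k
  (adjoint_op_test Q hf).
exists K => s delta s0 delta0; rewrite (_ : - \sum_m _ =
  phase_mean k (dt (adjoint_op Q f)) s + drift k * phase_mean k (dx (adjoint_op Q f)) s
    - \sum_m Lambda_mx lam k m * phase_mean m (adjoint_op Q f) s); first exact: hK.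
under eq_bigr do rewrite phase_mean_adjoint_op//.
rewrite big_split/= (bigD1 k)//= eqxx big1 => [|m].
  rewrite addr0 opprD; congr (_ - _).
  move: (phase_mean k (dt _) s) (phase_mean k (dx _) s) (drift _) => u v q.
  by clear; ring.
by rewrite eq_sym => /negPf ->.
Qed.

(** The sum over [j] of the rows of the system, row [j] being tested against
    the image of [phi] under the adjoint of [\adj M i j], leaves by [\adj M * M
    = \det M] the pairing of [f_i] with the image of [phi] under the adjoint of
    [\det M]. *)
Lemma gen_solution_det_op : gen_solution (det_op a c lam) (p_density P L D).
Proof.
move=> phi hphi; have [sphi [t0 [t1 [t00 supp]]] _] := hphi.
pose adj i j := (\adj (op) i j).
pose F t := \sum_i \sum_j - phase_mean j (adjoint_op (adj i j) phi) t.
pose p t := \sum_i phase_mean i (adjoint_op (det_op a c lam) phi) t.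
have pE : (fun t => p_density P L D t (fun x => adjoint_op (det_op a c lam) phi (x, t))) = p.
  by apply/funext => t; apply: eq_bigr => k _; exact: f_density_phase_mean.
rewrite [LHS](_ : _ = \int[lebesgue_measure]_(t in `]0, +oo[) p t); last first.
  by rewrite -pE.
have hdet := adjoint_op_test (det_op a c lam) hphi.
have fo : first_order F p.
  have [K hK] := first_order_sum (index_enum 'I_(2 ^ n)) (fun i =>
    first_order_sum (index_enum 'I_(2 ^ n)) (fun j =>
      first_orderN (phase_mean_adjoint_first_order j (adj i j) hphi))).
  exists K => s delta s0 delta0; rewrite (_ : p s = \sum_i \sum_j
    - - \sum_m phase_mean m (adjoint_op (op j m * adj i j) phi) s); first exact: hK.
  apply: eq_bigr => i _; under eq_bigr do rewrite opprK.
  (* Column by column, the sum over the rows is an entry of [\adj M * M]. *)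
  rewrite exchange_big/=.
  have ad m : \sum_j phase_mean m (adjoint_op (op j m * adj i j) phi) s =
      phase_mean m (adjoint_op (\det op *+ (i == m)) phi) s.
    rewrite -phase_mean_sum//; last by move=> j; exact: adjoint_op_test.
    congr (phase_mean m _ s); apply/funext => z.
    rewrite -adjoint_op_sum; congr adjoint_op.
    have := congr1 (fun B : 'M[{poly {poly R}}]_(2 ^ n) => B i m) (mul_adj_mx op).
    rewrite !mxE => <-; apply: eq_bigr => j _; exact: mulrC.
  under eq_bigr do rewrite ad.
  rewrite (bigD1 i)//= eqxx mulr1n big1 ?addr0// => m mi.
  rewrite eq_sym (negPf mi) mulr0n.
  by apply: phase_mean_eq0 => x; exact: adjoint_op0.
have [M hM] := test_function_bounded [::] hdet.
have [C hC] : exists C : R, forall s delta, 0 <= s -> 0 < delta <= 1 ->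
    `|p (s + delta) - p s| <= C * delta.
  have fop := first_order_sum (index_enum 'I_(2 ^ n)) (fun i =>
     phase_mean_first_order i hdet).
  apply: (first_order_lip (M := \sum_(i < 2 ^ n) M) fop) => t t0'.
  apply: le_trans (ler_norm_sum _ _ _) _; apply: ler_sum => i _.
  exact: phase_mean_bounded.
apply: (integral_of_derive (t1 := t1) t00 fo hC) => t htt; split.
  rewrite /F big1// => i _; rewrite big1// => j _; apply/eqP; rewrite oppr_eq0.
  by rewrite phase_mean_eq0// => x; exact: adjoint_op_support supp _ _ htt.
rewrite /p big1// => i _; apply: phase_mean_eq0 => x.
exact: adjoint_op_support supp _ _ htt.
Qed.


End TelegraphSum.

(** * The equation satisfied by the transition density *)

Theorem theorem2 (R : realType) (d : measure_display) (T : measurableType d)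
    (P : probability T R) (n : nat) (hn : (2 <= n)%N)
    (c lam x0 a : 'I_n -> R)
    (hc : forall k, 0 < c k) (hlam : forall k, 0 < lam k)
    (ha : forall k, a k != 0)
    (D0 : 'I_n -> T -> R) (N : 'I_n -> R -> T -> nat)
    (hD0 : forall k, initial_direction P (D0 k))
    (hN : forall k, poisson_process P (lam k) (N k))
    (hindep : independent_telegraph_data P D0 N) :
  let D := fun k => direction (D0 k) (N k) in
  let X := fun k => telegraph (c k) (x0 k) (D0 k) (N k) in
  let L := lin_comb a X in
  [/\ op_order (det_op a c lam) = (2 ^ n)%N,
      hyperbolic (det_op a c lam)
    & gen_solution (det_op a c lam) (p_density P L D)].
Proof.
move=> D X L; split.
- exact: op_order_det_op.
- exact: hyperbolic_det_op.
- exact: gen_solution_det_op.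
Qed.
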